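(* Let $q^1,\dots,q^N$ be i.i.d. samples from a distribution $\mathbb P$ on $\Delta_n$, and let $\breve p^N=\frac1N\sum_{k=1}^Np^k$, where $p^1=(1/n,\dots,1/n)^\top$ and $$p^{k+1}=\frac{p^k\odot\exp\big(-\eta\nabla_{p}W(p^k,q^k)\big)}{\sum_{j=1}^n[p^k]_j\exp\big(-\eta[\nabla_{p}W(p^k,q^k)]_j\big)},\qquad\eta=\frac{\sqrt{2\log n}}{\|C\|_\infty\sqrt N}$$ (stochastic mirror descent). Let $W(p)=\mathbb{E}_{q\sim\mathbb P}W(p,q)$ and $p^*\in\arg\min_{p\in\Delta_n}W(p)$. Then with probability at least $1-\beta$, $$W(\breve p^N)-W(p^* )=O\left(\frac{\|C\|_\infty\sqrt{\log(n/\beta)}}{\sqrt N}\right).$$ Let the algorithm be run with $N=\widetilde O\left(\frac{M_\infty^2R^2}{\varepsilon^2}\right)=\widetilde O\left(\frac{\|C\|_\infty^2}{\varepsilon^2}\right)$, where $R^2=\mathrm{KL}(p^*,p^1)\le\log n$. Then with probability at least $1-\beta$, $W(\breve p^N)-W(p^* )\le\varepsilon$. The total complexity of the algorithm is $\widetilde O\left(\frac{n^3\|C\|_\infty^2}{\varepsilon^2}\right)$.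
   Context: $\Delta_n$ is the probability simplex; $C\in\mathbb{R}^{n\times n}_+$ is a symmetric cost matrix with $\|C\|_\infty$ its largest entry; $W(p,q)=\min\{\langle C,\pi\rangle:\pi\in\mathbb{R}^{n\times n}_+,\pi\mathbf 1=p,\pi^\top\mathbf 1=q\}$. $\nabla_pW(p,q)=u^*$, where $(u^*,\nu^* )$ solves $\max\{\langle u,p\rangle+\langle\nu,q\rangle:u_i+\nu_j\le C_{ij}\ \forall i,j\}$ with $\langle u^*,\mathbf 1\rangle=0$; it is computed exactly by a linear programming solver at cost $\widetilde O(n^3)$. $\odot$ is the element-wise product; $\exp$ is element-wise. $\mathrm{KL}(x,y)=\langle x,\log(x/y)\rangle-\mathbf 1^\top(x-y)$. Standing convention: measures are bounded away from the boundary of $\Delta_n$ (after adding a small noise and normalizing), so that $W(\cdot,q)$ is $M_\infty$-Lipschitz in the $\ell_1$-norm with $M_\infty=O(\|C\|_\infty)$. $\widetilde O$ hides logarithmic factors; setting a parameter to $\widetilde O(E)$ means with a suitable constant and logarithmic factor; complexity counts arithmetic operations. *)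

(* Defs.v *)
From HB Require Import structures.
From mathcomp Require Import all_boot all_order all_algebra.
From mathcomp Require Import all_classical all_reals all_analysis.

Set Implicit Arguments.
Unset Strict Implicit.
Unset Printing Implicit Defensive.

Import Order.TTheory GRing.Theory Num.Theory.
Import numFieldNormedType.Exports.

Local Open Scope classical_set_scope.
Local Open Scope ring_scope.

(* Vectors of R^n are n-tuples, which carry the product Borel sigma-algebra.  *)

Definition simplex (R : realType) (n : nat) : set (n.-tuple R) :=
  [set p | (forall i, 0 <= tnth p i) /\ \sum_(i < n) tnth p i = 1].
Arguments simplex : clear implicits.

Definition uniform (R : realType) (n : nat) : n.-tuple R :=
  [tuple n%:R^-1 | i < n].
Arguments uniform : clear implicits.

Definition dot (R : realType) (n : nat) (x y : n.-tuple R) : R :=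
  \sum_(i < n) tnth x i * tnth y i.

Definition cost_matrix (R : realType) (n : nat) (C : 'M[R]_n) : Prop :=
  (forall i j, 0 <= C i j) /\ (forall i j, C i j = C j i).

(* For C >= 0 and n > 0 the default value 0 does not affect the maximum.      *)
Definition max_entry (R : realType) (n : nat) (C : 'M[R]_n) : R :=
  \big[Order.max/0]_(i < n) \big[Order.max/0]_(j < n) C i j.

Definition transport_plan (R : realType) (n : nat) (p q : n.-tuple R) :
    set 'M[R]_n :=
  [set pi | [/\ forall i j, 0 <= pi i j,
                forall i, \sum_(j < n) pi i j = tnth p i &
                forall j, \sum_(i < n) pi i j = tnth q j]].

(* On the simplex the set of plans is compact and nonempty, so that the       *)
(* infimum is a minimum.                                                      *)
Definition OT (R : realType) (n : nat) (C : 'M[R]_n) (p q : n.-tuple R) : R :=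
  inf [set \sum_(i < n) \sum_(j < n) C i j * pi i j
      | pi in transport_plan p q].

Definition dual_feasible (R : realType) (n : nat) (C : 'M[R]_n)
    (u v : n.-tuple R) : Prop :=
  forall i j, tnth u i + tnth v j <= C i j.

Definition dual_optimal (R : realType) (n : nat) (C : 'M[R]_n)
    (p q u v : n.-tuple R) : Prop :=
  dual_feasible C u v /\
  forall u' v', dual_feasible C u' v' -> dot u' p + dot v' q <= dot u p + dot v q.

(* u is a value of the gradient of OT C _ q at p; the normalised dual optimum *)
(* need not be unique, hence a relation.                                      *)
Definition OT_gradient (R : realType) (n : nat) (C : 'M[R]_n)
    (p q u : n.-tuple R) : Prop :=
  (exists v, dual_optimal C p q u v) /\ \sum_(i < n) tnth u i = 0.

Definition KL (R : realType) (n : nat) (x y : n.-tuple R) : R :=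
  \sum_(i < n) tnth x i * ln (tnth x i / tnth y i)
  - \sum_(i < n) (tnth x i - tnth y i).

Definition l1_lipschitz (R : realType) (n : nat) (M : R)
    (f : n.-tuple R -> R) : Prop :=
  forall p p', simplex R n p -> simplex R n p' ->
    `|f p - f p'| <= M * \sum_(i < n) `|tnth p i - tnth p' i|.

Definition mean_OT (R : realType) (n : nat) (C : 'M[R]_n)
    (P : probability (n.-tuple R) R) (p : n.-tuple R) : R :=
  \int[P]_(q in simplex R n) OT C p q.

Definition mean_OT_argmin (R : realType) (n : nat) (C : 'M[R]_n)
    (P : probability (n.-tuple R) R) (p : n.-tuple R) : Prop :=
  simplex R n p /\ forall p', simplex R n p' -> mean_OT C P p <= mean_OT C P p'.

(* X 0, ..., X (N - 1) take their values in the simplex, have law P and are   *)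
(* mutually independent (take A k = setT to get the rule for subfamilies).    *)
Definition iid_samples (R : realType) (n N : nat) (d : measure_display)
    (T : measurableType d) (Pr : probability T R)
    (P : probability (n.-tuple R) R) (X : nat -> {RV Pr >-> n.-tuple R}) : Prop :=
  [/\ forall k w, (k < N)%N -> simplex R n (X k w),
      forall k A, (k < N)%N -> measurable A -> distribution Pr (X k) A = P A &
      forall A : nat -> set (n.-tuple R), (forall k, measurable (A k)) ->
        Pr [set w | forall k, (k < N)%N -> A k (X k w)] =
        (\prod_(k < N) Pr (X k @^-1` A k))%E].
Arguments iid_samples {R n} N {d T Pr} P X.

Definition with_probability (R : realType) (d : measure_display)
    (T : measurableType d) (Pr : probability T R) (a : R) (E : set T) : Prop :=
  measurable E /\ (a%:E <= Pr E)%E.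

Definition smd_stepsize (R : realType) (n : nat) (C : 'M[R]_n) (N : nat) : R :=
  Num.sqrt (2 * ln n%:R) / (max_entry C * Num.sqrt N%:R).

Definition smd_step (R : realType) (n : nat)
    (g : n.-tuple R -> n.-tuple R -> n.-tuple R) (eta : R)
    (p q : n.-tuple R) : n.-tuple R :=
  [tuple tnth p i * expR (- eta * tnth (g p q) i)
         / \sum_(j < n) tnth p j * expR (- eta * tnth (g p q) j) | i < n].

(* Indices are shifted by one: smd_iter g eta q k is p^(k+1) and q k is       *)
(* q^(k+1).                                                                   *)
Fixpoint smd_iter (R : realType) (n : nat)
    (g : n.-tuple R -> n.-tuple R -> n.-tuple R) (eta : R)
    (q : nat -> n.-tuple R) (k : nat) : n.-tuple R :=
  if k is k'.+1 then smd_step g eta (smd_iter g eta q k') (q k')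
  else uniform R n.

Definition smd_average (R : realType) (n : nat) (C : 'M[R]_n)
    (g : n.-tuple R -> n.-tuple R -> n.-tuple R) (N : nat)
    (q : nat -> n.-tuple R) : n.-tuple R :=
  [tuple N%:R^-1 *
         \sum_(k < N) tnth (smd_iter g (smd_stepsize C N) q k) i | i < n].

(* Real-arithmetic programs: every node other than Ret is one operation on    *)
(* reals (loading an integer constant, a field operation, exp, ln, sqrt or a  *)
(* comparison); indexing and copying are free.                                *)
Inductive unop := OpExp | OpLn | OpSqrt.
Inductive binop := OpAdd | OpSub | OpMul | OpDiv.

Inductive prog (R : realType) (A : Type) : Type :=
| Ret of A
| Const of nat & (R -> prog R A)
| Un of unop & R & (R -> prog R A)
| Bin of binop & R & R & (R -> prog R A)
| Cmp of R & R & (bool -> prog R A).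
Arguments Ret {R A} _.

Definition eval_unop (R : realType) (o : unop) (x : R) : R :=
  match o with OpExp => expR x | OpLn => ln x | OpSqrt => Num.sqrt x end.

Definition eval_binop (R : realType) (o : binop) (x y : R) : R :=
  match o with
  | OpAdd => x + y | OpSub => x - y | OpMul => x * y | OpDiv => x / y
  end.

Fixpoint run (R : realType) (A : Type) (t : prog R A) : A :=
  match t with
  | Ret a => a
  | Const m k => run (k m%:R)
  | Un o x k => run (k (eval_unop o x))
  | Bin o x y k => run (k (eval_binop o x y))
  | Cmp x y k => run (k (x <= y))
  end.

Fixpoint ops (R : realType) (A : Type) (t : prog R A) : nat :=
  match t with
  | Ret _ => 0
  | Const m k => (ops (k m%:R)).+1
  | Un o x k => (ops (k (eval_unop o x))).+1
  | Bin o x y k => (ops (k (eval_binop o x y))).+1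
  | Cmp x y k => (ops (k (x <= y))).+1
  end.

Fixpoint bind (R : realType) (A B : Type) (t : prog R A) (f : A -> prog R B) :
    prog R B :=
  match t with
  | Ret a => f a
  | Const m k => Const m (fun x => bind (k x) f)
  | Un o x k => Un o x (fun z => bind (k z) f)
  | Bin o x y k => Bin o x y (fun z => bind (k z) f)
  | Cmp x y k => Cmp x y (fun b => bind (k b) f)
  end.

Local Notation "'do' x <- t ; u" := (bind t (fun x => u))
  (at level 200, x name, t at level 100, u at level 200).

Definition const (R : realType) (m : nat) : prog R R := Const m Ret.
Arguments const : clear implicits.
Definition un (R : realType) (o : unop) (x : R) : prog R R := Un o x Ret.
Definition bin (R : realType) (o : binop) (x y : R) : prog R R := Bin o x y Ret.

Fixpoint mapM (R : realType) (I A : Type) (f : I -> prog R A) (s : seq I) :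
    prog R (seq A) :=
  if s is i :: s' then do a <- f i; do r <- mapM f s'; Ret (a :: r)
  else Ret [::].

Fixpoint foldM (R : realType) (I A : Type) (f : A -> I -> prog R A) (a : A)
    (s : seq I) : prog R A :=
  if s is i :: s' then do b <- f a i; foldM f b s' else Ret a.

Definition vecM (R : realType) (n : nat) (f : 'I_n -> prog R R) :
    prog R (n.-tuple R) :=
  do s <- mapM f (enum 'I_n); Ret [tuple s`_i | i < n].

Definition sum_prog (R : realType) (n : nat) (x : n.-tuple R) : prog R R :=
  do z <- const R 0; foldM (fun a i => bin OpAdd a (tnth x i)) z (enum 'I_n).

Definition max_entry_prog (R : realType) (n : nat) (C : 'M[R]_n) : prog R R :=
  do z <- const R 0;
  foldM (fun a i =>
      foldM (fun b j => Cmp b (C i j) (fun c => Ret (if c then C i j else b)))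
        a (enum 'I_n))
    z (enum 'I_n).

Definition stepsize_prog (R : realType) (n : nat) (C : 'M[R]_n) (N : nat) :
    prog R R :=
  do two <- const R 2;
  do n' <- const R n;
  do N' <- const R N;
  do l <- un OpLn n';
  do l2 <- bin OpMul two l;
  do num <- un OpSqrt l2;
  do c <- max_entry_prog C;
  do r <- un OpSqrt N';
  do den <- bin OpMul c r;
  bin OpDiv num den.

Definition step_prog (R : realType) (n : nat)
    (solver : n.-tuple R -> n.-tuple R -> prog R (n.-tuple R)) (eta : R)
    (p q : n.-tuple R) : prog R (n.-tuple R) :=
  do u <- solver p q;
  do z <- const R 0;
  do w <- vecM (fun i =>
            do a <- bin OpMul eta (tnth u i);
            do b <- bin OpSub z a;
            do e <- un OpExp b;
            bin OpMul (tnth p i) e);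
  do s <- sum_prog w;
  vecM (fun i => bin OpDiv (tnth w i) s).

Fixpoint loop_prog (R : realType) (n : nat)
    (solver : n.-tuple R -> n.-tuple R -> prog R (n.-tuple R)) (eta : R)
    (p acc : n.-tuple R) (qs : seq (n.-tuple R)) : prog R (n.-tuple R) :=
  if qs is q :: qs' then
    do acc' <- vecM (fun i => bin OpAdd (tnth acc i) (tnth p i));
    do p' <- step_prog solver eta p q;
    loop_prog solver eta p' acc' qs'
  else Ret acc.

(* Stochastic mirror descent on the list of samples qs, the linear            *)
(* programming solver being called as a subroutine.                           *)
Definition smd_prog (R : realType) (n : nat) (C : 'M[R]_n)
    (solver : n.-tuple R -> n.-tuple R -> prog R (n.-tuple R))
    (qs : seq (n.-tuple R)) : prog R (n.-tuple R) :=
  do eta <- stepsize_prog C (size qs);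
  do one <- const R 1;
  do zero <- const R 0;
  do n' <- const R n;
  do N' <- const R (size qs);
  do p <- bin OpDiv one n';
  do acc <- loop_prog solver eta [tuple p | i < n] [tuple zero | i < n] qs;
  vecM (fun i => bin OpDiv (tnth acc i) N').

(* The solver is an exact one: on the simplex it returns a gradient, as a     *)
(* Borel function of (p, q), in at most a n^3 (1 + ln n)^b operations.        *)
Definition lp_solver (R : realType) (n : nat) (C : 'M[R]_n) (a : R) (b : nat)
    (solver : n.-tuple R -> n.-tuple R -> prog R (n.-tuple R)) : Prop :=
  [/\ forall p q, simplex R n p -> simplex R n q ->
        OT_gradient C p q (run (solver p q)),
      measurable_fun (simplex R n `*` simplex R n)
        (fun pq : n.-tuple R * n.-tuple R => run (solver pq.1 pq.2)) &
      forall p q, simplex R n p -> simplex R n q ->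
        (ops (solver p q))%:R <= a * n%:R ^+ 3 * (1 + ln n%:R) ^+ b].

(* Main.v *)
(** OT duality: among the nonnegative matrices supported by the tight pairs of
    a dual optimum (u, v), the one whose marginals are closest to (p, q) in
    least squares has these marginals exactly, since otherwise the residuals
    would be an improving direction for the dual. Hence <u, p> + <v, q> is the
    transport cost, u is a subgradient, and at a positive p its oscillation is
    at most M, the largest entry of C.

    The exponential-weights potential then bounds the cumulative excess
    [sum_k OT(p^k, q^k) - OT(pstar, q^k)] by a multiple of [M sqrt (N ln n)],
    whatever the samples. The difference between the true excess
    [sum_k W(p^k) - W(pstar)] and this empirical one is a sum of martingale
    increments bounded by 2M, whose exponential moments are controlled one
    sample at a time by Tonelli's theorem and the inequality
    [exp x <= x + exp (2 x^2)]; Chernoff's bound and the convexity of W conclude. *)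

Require Import Defs.
From HB Require Import structures.
From mathcomp Require Import all_boot all_order all_algebra.
From mathcomp Require Import all_classical all_reals all_analysis.
From mathcomp Require Import measurable_realfun ring lra.
Import Order.TTheory GRing.Theory Num.Theory.
Import numFieldNormedType.Exports.
Local Open Scope classical_set_scope.
Local Open Scope ring_scope.

Set Implicit Arguments.
Unset Strict Implicit.
Unset Printing Implicit Defensive.

(** * Continuity of finite sums and squared differences *)

Section continuity.
Context (R : realType) (T : topologicalType) (x : T).
Implicit Types F G : T -> R.

Lemma continuous_addR F G : {for x, continuous F} -> {for x, continuous G} ->
  {for x, continuous (fun y => F y + G y)}.
Proof. by move=> cF cG; apply: (@continuousD R R^o). Qed.

Lemma continuous_sqr_subR F c : {for x, continuous F} ->
  {for x, continuous (fun y => (c - F y) ^+ 2)}.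
Proof.
move=> cF; have cB : {for x, continuous (fun y => c - F y)}.
  by apply: (@continuousB R R^o) => //; exact: cst_continuous.
exact: (@continuousM R).
Qed.

Lemma continuous_sumR (I : finType) (F : I -> T -> R) :
  (forall i, {for x, continuous (F i)}) ->
  {for x, continuous (fun y => \sum_i F i y)}.
Proof.
move=> cF; elim: (index_enum I) => [|i r IH].
  rewrite (_ : (fun h => _) = cst 0); first exact: cst_continuous.
  by apply/funext => h; rewrite big_nil.
rewrite (_ : (fun h => _) = (fun h => F i h + \sum_(j <- r) F j h)).
  exact: continuous_addR.
by apply/funext => h; rewrite big_cons.
Qed.

End continuity.

(** * Least-squares fitting of marginals on a prescribed support *)

Section least_squares_plan.
Context (R : realType) (n : nat).
Variables (E : 'I_n -> 'I_n -> bool) (p q : n.-tuple R).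
Hypotheses (p1 : forall i, tnth p i <= 1) (q1 : forall i, tnth q i <= 1).

Local Notation plan := (prod_topology (fun _ : 'I_n * 'I_n => R)).

Let row_gap (f : plan) i := tnth p i - \sum_j f (i, j).
Let col_gap (f : plan) j := tnth q j - \sum_i f (i, j).
Let gap f := \sum_i row_gap f i ^+ 2 + \sum_j col_gap f j ^+ 2.

(** The cap 2 makes the box compact by Tychonoff's theorem. It does not disturb the first-order
    conditions: the prescribed marginals are at most 1, so an entry at the cap leaves both of its
    gaps negative. *)
Let box : set plan :=
  [set f | forall ij, [set` `[0, if E ij.1 ij.2 then 2 else 0]] (f ij)].

Let box_min : exists2 f, f \in box & forall h, h \in box -> gap f <= gap h.
Proof.
apply: (@compact_EVT_min (prod_topology (fun _ : 'I_n * 'I_n => R))) => /=.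
- by exists (fun=> 0) => ij /=; rewrite in_itv/= lexx/=; case: ifP.
- exact: (@tychonoff _ (fun=> R) _ (fun ij => @segment_compact R _ _)).
- apply: continuous_subspaceT => f.
  have Pc ij : {for f, continuous (fun h : plan => h ij)}.
    exact: (@proj_continuous _ (fun=> R) ij f).
  apply: continuous_addR; apply: continuous_sumR => i; apply: continuous_sqr_subR;
    by apply: continuous_sumR => j; exact: Pc.
Qed.

(** Changing one entry by [t] lowers one row gap and one column gap by [t]. This exact quadratic
    expansion replaces differentiation. *)
Let gap_shift f i j t :
  gap (fun ij => f ij + (ij == (i, j))%:R * t) =
  gap f - 2 * t * (row_gap f i + col_gap f j) + 2 * t ^+ 2.
Proof.
have S (x : 'I_n) (F : 'I_n -> R) :
    \sum_y (F y - (y == x)%:R * t) ^+ 2 = \sum_y F y ^+ 2 - 2 * t * F x + t ^+ 2.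
  rewrite (bigD1 x)//= [in RHS](bigD1 x)//= eqxx mul1r.
  rewrite (eq_bigr (fun y => F y ^+ 2)); first by ring.
  by move=> y /negPf ->; rewrite mul0r subr0.
rewrite /gap.
have -> : \sum_i0 row_gap (fun ij => f ij + (ij == (i, j))%:R * t) i0 ^+ 2 =
    \sum_x (row_gap f x - (x == i)%:R * t) ^+ 2.
  apply: eq_bigr => x _; congr (_ ^+ 2); rewrite /row_gap big_split/= opprD addrA.
  congr (_ - _); rewrite (bigD1 j)//= xpair_eqE eqxx andbT big1 ?addr0// => y yj.
  by rewrite xpair_eqE (negPf yj) andbF mul0r.
have -> : \sum_j0 col_gap (fun ij => f ij + (ij == (i, j))%:R * t) j0 ^+ 2 =
    \sum_x (col_gap f x - (x == j)%:R * t) ^+ 2.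
  apply: eq_bigr => x _; congr (_ ^+ 2); rewrite /col_gap big_split/= opprD addrA.
  congr (_ - _); rewrite (bigD1 i)//= xpair_eqE eqxx /= big1 ?addr0// => y yj.
  by rewrite xpair_eqE (negPf yj) mul0r.
rewrite !S; ring.
Qed.

(* First-order conditions for minimising the squared distance between the     *)
(* marginals and (p, q) among the nonnegative matrices supported by E.        *)
Lemma least_squares_plan : exists (f : 'I_n -> 'I_n -> R) (r s : 'I_n -> R),
  [/\ forall i j, 0 <= f i j,
      forall i, tnth p i = r i + \sum_j f i j,
      forall j, tnth q j = s j + \sum_i f i j,
      forall i j, E i j -> r i + s j <= 0 &
      forall i j, f i j != 0 -> E i j /\ r i + s j = 0].
Proof.
have [f fB fmin] := box_min.
have f0 i j : 0 <= f (i, j).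
  by move: fB; rewrite inE => /(_ (i, j)) /=; rewrite in_itv/= => /andP[].
have f2 i j : E i j -> f (i, j) <= 2.
  by move=> Eij; move: fB; rewrite inE => /(_ (i, j)) /=;
    rewrite in_itv/= Eij => /andP[].
have fE i j : f (i, j) != 0 -> E i j.
  apply: contraNT => /negPf Eij; rewrite eq_le f0 andbT.
  by move: fB; rewrite inE => /(_ (i, j)) /=; rewrite in_itv/= Eij => /andP[].
(* Minimality tested on a single-entry perturbation that stays in the box. *)
have shift i j t : E i j -> 0 <= f (i, j) + t <= 2 ->
    t * (row_gap f i + col_gap f j) <= t ^+ 2.
  move=> Eij /andP[t0 t2].
  have : (fun ij => f ij + (ij == (i, j))%:R * t) \in box.
    rewrite inE => -[x y] /=; rewrite in_itv/= xpair_eqE.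
    have [->|xi] /= := eqVneq x i; last first.
      rewrite mul0r addr0 f0 /=; case: ifPn => [/f2//|].
      by apply: contraNT; rewrite -ltNge => h; apply: fE; rewrite gt_eqF.
    have [->|yj] /= := eqVneq y j; first by rewrite Eij mul1r t0.
    rewrite mul0r addr0 f0 /=; case: ifPn => [/f2//|].
    by apply: contraNT; rewrite -ltNge => h; apply: fE; rewrite gt_eqF.
  move=> /fmin; rewrite gap_shift; lra.
have pos i j : f (i, j) != 0 -> 0 <= row_gap f i + col_gap f j.
  move=> fn0; have fij : 0 < f (i, j) by rewrite lt_def fn0 f0.
  rewrite leNgt; apply/negP => h.
  have Eij := fE _ _ fn0; have := f2 _ _ Eij.
  (* Lowering the entry by [t] keeps it nonnegative, and [t] at most half the size of the negative
     gap sum makes the linear gain at least [2 * t ^+ 2], which beats the quadratic loss allowed by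
     [shift]. *)
  pose t := Num.min (f (i, j)) (- (row_gap f i + col_gap f j) / 2).
  have t0 : 0 < t by rewrite lt_min fij/= divr_gt0// oppr_gt0.
  have tf : t <= f (i, j) by rewrite ge_min lexx.
  have tg : t <= - (row_gap f i + col_gap f j) / 2 by rewrite ge_min lexx orbT.
  move=> fle2; have := shift i j (- t) Eij; rewrite subr_ge0 tf /=.
  rewrite (le_trans _ fle2) ?lerBlDr ?lerDl ?(ltW t0)// => /(_ isT); nra.
have neg i j : E i j -> row_gap f i + col_gap f j <= 0.
  move=> Eij; rewrite leNgt; apply/negP => h.
  have [f_lt2|f_ge2] := ltP (f (i, j)) 2.
    pose t := Num.min (2 - f (i, j)) ((row_gap f i + col_gap f j) / 2).
    have t0 : 0 < t by rewrite lt_min subr_gt0 f_lt2/= divr_gt0.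
    have tf : t <= 2 - f (i, j) by rewrite ge_min lexx.
    have tg : t <= (row_gap f i + col_gap f j) / 2 by rewrite ge_min lexx orbT.
    have := shift i j t Eij; rewrite addr_ge0 ?f0 ?(ltW t0)//= => /(_ _); nra.
  (* At the cap, the row and column sums are at least 2 while [p] and [q] are at most 1, so the gap
     sum cannot be positive. *)
  have rs (F : 'I_n -> R) k : (forall l, 0 <= F l) -> F k <= \sum_l F l.
    by move=> F0; rewrite (bigD1 k)//= lerDl sumr_ge0.
  have := rs (fun j => f (i, j)) j (f0 i).
  have := rs (fun i => f (i, j)) i (fun i => f0 i j).
  have := p1 i; have := q1 j; move: h; rewrite /row_gap /col_gap; lra.
exists (fun i j => f (i, j)), (row_gap f), (col_gap f); split => //.
- by move=> i; rewrite /row_gap subrK.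
- by move=> j; rewrite /col_gap subrK.
- move=> i j fn0; split; first exact: fE.
  by apply/eqP; rewrite eq_le pos// neg// fE.
Qed.

End least_squares_plan.

(** * Kantorovich duality and its consequences: subgradients, oscillation, Lipschitz bound,
    convexity *)

Section transport_duality.
Context (R : realType) (n : nat).
Implicit Types (C pi : 'M[R]_n) (p q u v : n.-tuple R).

Let cost C pi := \sum_(i < n) \sum_(j < n) C i j * pi i j.

Lemma max_entry_ge C i j : C i j <= max_entry C.
Proof.
apply: le_trans (le_bigmax_cond _ (fun i => \big[Order.max/0]_j C i j) (isT : xpredT i)).
exact: (le_bigmax_cond _ (fun j => C i j) (isT : xpredT j)).
Qed.

Lemma simplex_le1 p i : simplex R n p -> tnth p i <= 1.
Proof. by move=> [p0 <-]; rewrite (bigD1 i)//= lerDl sumr_ge0. Qed.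

Lemma dot_plan p q pi u v : transport_plan p q pi ->
  dot u p + dot v q = \sum_(i < n) \sum_(j < n) (tnth u i + tnth v j) * pi i j.
Proof.
move=> [_ pi1 pi2]; rewrite /dot.
under eq_bigr => i _ do rewrite -pi1 mulr_sumr.
under [X in _ + X]eq_bigr => j _ do rewrite -pi2 mulr_sumr.
rewrite [X in _ + X]exchange_big/= -big_split/=; apply: eq_bigr => i _.
by rewrite -big_split/=; apply: eq_bigr => j _; rewrite mulrDl.
Qed.

Lemma weak_duality C p q pi u v : dual_feasible C u v ->
  transport_plan p q pi -> dot u p + dot v q <= cost C pi.
Proof.
move=> uv ppi; rewrite (dot_plan _ _ ppi); have [pi0 _ _] := ppi.
by apply: ler_sum => i _; apply: ler_sum => j _; rewrite ler_wpM2r.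
Qed.

Lemma product_plan p q : simplex R n p -> simplex R n q ->
  transport_plan p q (\matrix_(i, j) (tnth p i * tnth q j)).
Proof.
move=> [p0 p1] [q0 q1]; split => [i j|i|j].
- by rewrite mxE mulr_ge0.
- by under eq_bigr do rewrite mxE; rewrite -mulr_sumr q1 mulr1.
- by under eq_bigr do rewrite mxE; rewrite -mulr_suml p1 mul1r.
Qed.

Lemma OT_ge_dual C p q u v : simplex R n p -> simplex R n q ->
  dual_feasible C u v -> dot u p + dot v q <= OT C p q.
Proof.
move=> sp sq uv; apply: lb_le_inf.
  (* A lower bound passes to [inf] only for a nonempty set; the product plan supplies an element. *)
  by eexists; exists (\matrix_(i, j) (tnth p i * tnth q j)); [exact: product_plan|].
by move=> _ [pi ppi <-]; exact: weak_duality.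
Qed.

Lemma OT_le_cost C p q pi : cost_matrix C -> transport_plan p q pi ->
  OT C p q <= cost C pi.
Proof.
move=> [C0 _] ppi; apply: ge_inf; last by exists pi.
exists 0 => _ [pi' [pi0 _ _] <-].
by apply: sumr_ge0 => i _; apply: sumr_ge0 => j _; rewrite mulr_ge0.
Qed.

Lemma OT_ge0 C p q : cost_matrix C -> 0 <= OT C p q.
Proof.
move=> [C0 _]; rewrite /OT; set S := [set _ | _ in _].
(* Marginals off the simplex may admit no plan; [inf] then takes its default value 0. *)
have [->|/set0P S0] := eqVneq S set0; first by rewrite inf0.
apply: lb_le_inf => // _ [pi [pi0 _ _] <-].
by apply: sumr_ge0 => i _; apply: sumr_ge0 => j _; rewrite mulr_ge0.
Qed.

Lemma OT_le_max C p q : cost_matrix C -> simplex R n p -> simplex R n q ->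
  OT C p q <= max_entry C.
Proof.
move=> cC sp sq; apply: le_trans (OT_le_cost cC (product_plan sp sq)) _.
have [[p0 p1] [q0 q1]] := (sp, sq).
have -> : max_entry C = \sum_i \sum_j max_entry C * (tnth p i * tnth q j).
  under eq_bigr do rewrite -mulr_sumr -mulr_sumr q1 mulr1.
  by rewrite -mulr_sumr p1 mulr1.
apply: ler_sum => i _; apply: ler_sum => j _.
by rewrite mxE ler_wpM2r ?mulr_ge0// max_entry_ge.
Qed.

(* Were the optimal residuals (r, s) of the least-squares plan on the tight   *)
(* pairs nonzero, moving (u, v) along (r, s) would improve the dual value.    *)
Lemma strong_duality C p q u v : simplex R n p -> simplex R n q ->
  dual_optimal C p q u v ->
  exists2 pi, transport_plan p q pi & cost C pi = dot u p + dot v q.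
Proof.
move=> sp sq [uv opt].
pose E i j := tnth u i + tnth v j == C i j.
have [f [r [s [f0 pE qE rs0 fE]]]] :=
  @least_squares_plan R n E p q (fun i => simplex_le1 i sp)
    (fun i => simplex_le1 i sq).
pose slack (ij : 'I_n * 'I_n) := C ij.1 ij.2 - (tnth u ij.1 + tnth v ij.2).
(* A step length that preserves feasibility pair by pair: on a tight pair [r + s <= 0] and any
   length works, elsewhere the slack bounds it, the summand 1 keeping the denominator positive. *)
pose del (ij : 'I_n * 'I_n) := if E ij.1 ij.2 then 1 else
  slack ij / (1 + `|r ij.1 + s ij.2|).
have del0 ij : 0 < del ij.
  rewrite /del; case: ifPn => // En.
  by apply: divr_gt0; [rewrite subr_gt0 lt_neqAle uv andbT|rewrite ltr_pwDl].
pose d := \big[Order.min/1]_ij del ij.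
have d0 : 0 < d by rewrite /d; elim/big_ind : _ => // x y x0 y0; rewrite lt_min x0.
have dle ij : d <= del ij by exact: bigmin_le_cond.
pose u' := [tuple tnth u i + d * r i | i < n].
pose v' := [tuple tnth v i + d * s i | i < n].
have uv' : dual_feasible C u' v'.
  move=> i j; rewrite !tnth_mktuple.
  have [Eij|Eij] := boolP (E i j).
    have := rs0 _ _ Eij; move: Eij => /eqP <-; nra.
  have := dle (i, j); rewrite /del/= (negPf Eij) ler_pdivlMr ?ltr_pwDl//.
  have := ler_norm (r i + s j); rewrite /slack/=; nra.
have := opt _ _ uv'.
have -> : dot u' p + dot v' q = dot u p + dot v q + d * (\sum_i r i ^+ 2 + \sum_i s i ^+ 2).
  (* Substituting the marginals as residual plus sum of [f] leaves the cross terms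
     [f i j * (r i + s j)], which vanish by complementarity. Hence the first-order gain of the dual
     value is the squared norm of the residuals. *)
  have -> : \sum_i r i ^+ 2 + \sum_i s i ^+ 2 =
      \sum_i r i * tnth p i + \sum_i s i * tnth q i.
    under [X in _ = X + _]eq_bigr => i _ do rewrite pE mulrDr -expr2 mulr_sumr.
    under [X in _ = _ + X]eq_bigr => i _ do rewrite qE mulrDr -expr2 mulr_sumr.
    rewrite !big_split/= addrACA [X in _ = _ + (_ + X)]exchange_big/=.
    rewrite -[X in _ = _ + X]big_split/= [X in _ = _ + X]big1 ?addr0// => i _.
    rewrite -big_split/= big1// => j _; rewrite -mulrDl.
    have [->|/fE[_ ->]] := eqVneq (f i j) 0; by rewrite ?mulr0 ?mul0r.
  rewrite mulrDr !mulr_sumr addrACA /dot -!big_split/=.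
  by apply: eq_bigr => i _; rewrite !tnth_mktuple; ring.
rewrite gerDl pmulr_rle0// => rs_le0.
have r20 : 0 <= \sum_i r i ^+ 2 by apply: sumr_ge0 => i _; exact: sqr_ge0.
have s20 : 0 <= \sum_i s i ^+ 2 by apply: sumr_ge0 => i _; exact: sqr_ge0.
have r0 i : r i = 0.
  have /eqP : \sum_i r i ^+ 2 = 0 by lra.
  rewrite psumr_eq0 => [/allP/(_ i (mem_index_enum _))/=|j _]; last exact: sqr_ge0.
  by rewrite sqrf_eq0 => /eqP.
have s0 i : s i = 0.
  have /eqP : \sum_i s i ^+ 2 = 0 by lra.
  rewrite psumr_eq0 => [/allP/(_ i (mem_index_enum _))/=|j _]; last exact: sqr_ge0.
  by rewrite sqrf_eq0 => /eqP.
have ppi : transport_plan p q (\matrix_(i, j) f i j).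
  split => [i j|i|j]; first by rewrite mxE.
  - by rewrite pE r0 add0r; apply: eq_bigr => j _; rewrite mxE.
  - by rewrite qE s0 add0r; apply: eq_bigr => i _; rewrite mxE.
exists (\matrix_(i, j) f i j) => //; rewrite (dot_plan _ _ ppi).
apply: eq_bigr => i _; apply: eq_bigr => j _; rewrite !mxE.
by have [->|/fE[/eqP -> _]] := eqVneq (f i j) 0; rewrite ?mulr0.
Qed.

Lemma OT_dual C p q u v : cost_matrix C -> simplex R n p -> simplex R n q ->
  dual_optimal C p q u v -> OT C p q = dot u p + dot v q.
Proof.
move=> cC sp sq uv; apply/eqP; rewrite eq_le; apply/andP; split.
  by have [pi ppi <-] := strong_duality sp sq uv; exact: OT_le_cost.
by apply: OT_ge_dual => //; case: uv.
Qed.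

(** Dual feasibility does not involve the marginals, so a pair optimal at [p] still gives a lower
    bound at [p']. *)
Lemma OT_subgradient C p p' q u v : cost_matrix C ->
  simplex R n p -> simplex R n p' -> simplex R n q ->
  dual_optimal C p q u v -> OT C p q - OT C p' q <= dot u p - dot u p'.
Proof.
move=> cC sp sp' sq uv; rewrite (OT_dual cC sp sq uv).
have [fuv _] := uv; have := OT_ge_dual sp' sq fuv; lra.
Qed.

(** Take for [u'] the c-transform of [v], the largest first potential compatible with [v]. Using the
    minimiser of row [k] as a competitor in row [i] bounds the difference by one of two cost
    entries. *)
Lemma c_transform C p q u v : cost_matrix C -> simplex R n p ->
  dual_optimal C p q u v ->
  exists u', [/\ dual_optimal C p q u' v, forall i, tnth u i <= tnth u' i &
                 forall i k, tnth u' i - tnth u' k <= max_entry C].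
Proof.
move=> [C0 _] [p0 _] [uv opt].
pose J i := [arg min_(j < i) (C i j - tnth v j)]%O.
have JP i j : C i (J i) - tnth v (J i) <= C i j - tnth v j.
  by rewrite /J; case: arg_minP => // k _ /(_ j isT).
pose u' := [tuple C i (J i) - tnth v (J i) | i < n].
have uu' i : tnth u i <= tnth u' i by rewrite tnth_mktuple lerBrDr uv.
exists u'; split => //; last first.
  move=> i k; rewrite !tnth_mktuple.
  have := JP i (J k); have := max_entry_ge C i (J k); have := C0 k (J k); lra.
split.
  by move=> i j; rewrite tnth_mktuple -lerBrDr.
move=> a b /opt /le_trans; apply; rewrite lerD2r.
by apply: ler_sum => i _; rewrite ler_wpM2r.
Qed.

(** The c-transform dominates [u] coordinatewise without a larger dual value; with positive weights
    [p] the two must coincide, so [u] inherits the oscillation bound. *)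
Lemma gradient_osc C p q u : cost_matrix C -> simplex R n p ->
  (forall i, 0 < tnth p i) -> OT_gradient C p q u ->
  forall i k, tnth u i - tnth u k <= max_entry C.
Proof.
move=> cC sp pgt0 [[v uv] _].
have [u' [uv' uu' osc]] := c_transform cC sp uv.
suff E i : tnth u i = tnth u' i by move=> i k; rewrite !E.
have [_ opt] := uv; have [/opt + _] := uv'; rewrite lerD2r => le.
have : \sum_i (tnth u' i - tnth u i) * tnth p i == 0.
  rewrite eq_le; apply/andP; split; last first.
    by apply: sumr_ge0 => k _; rewrite mulr_ge0 ?subr_ge0// ltW.
  by under eq_bigr do rewrite mulrBl; rewrite sumrB subr_le0.
rewrite psumr_eq0 => [/allP/(_ i (mem_index_enum _))/=|k _]; last first.
  by rewrite mulr_ge0 ?subr_ge0// ltW.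
by rewrite mulf_eq0 (gt_eqF (pgt0 i)) orbF subr_eq0 => /eqP.
Qed.

(** On the boundary of the simplex a dual optimum may oscillate more than the cost does, so the
    subgradient inequality is applied to its c-transform. *)
Lemma OT_lipschitz C q : cost_matrix C -> simplex R n q ->
  (forall p, simplex R n p -> exists u v, dual_optimal C p q u v) ->
  l1_lipschitz (max_entry C) (OT C ^~ q).
Proof.
move=> cC sq dual.
suff half p p' : simplex R n p -> simplex R n p' -> OT C p q - OT C p' q <=
    max_entry C * \sum_(i < n) `|tnth p i - tnth p' i|.
  move=> p p' sp sp'; rewrite ler_norml half// andbT lerNl opprB.
  by under eq_bigr do rewrite distrC; exact: half.
move=> sp sp'; have [u [v uv]] := dual _ sp.
have [u' [uv' _ osc]] := c_transform cC sp uv.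
apply: le_trans (OT_subgradient cC sp sp' sq uv') _.
(* Since [p] and [p'] have equal mass, the smallest coordinate can be subtracted from [u'], which
   leaves coefficients between 0 and [max_entry C]. *)
have [k _ kmin] : exists2 k : 'I_n, true & forall i, tnth u' k <= tnth u' i.
  case: (pickP 'I_n) => [i0 _|no].
    by exists [arg min_(j < i0) tnth u' j]%O => // i; case: arg_minP => // ? _; exact.
  by case: sp => _; rewrite big_pred0// => /eqP; rewrite eq_sym oner_eq0.
have -> : dot u' p - dot u' p' = \sum_i (tnth u' i - tnth u' k) * (tnth p i - tnth p' i).
  rewrite /dot -sumrB.
  have : \sum_i tnth u' k * (tnth p i - tnth p' i) = 0.
    by rewrite -mulr_sumr sumrB; case: sp => _ ->; case: sp' => _ ->; rewrite subrr mulr0.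
  move=> z; rewrite -[LHS]subr0 -[X in _ - X]z -sumrB.
  by apply: eq_bigr => i _; ring.
rewrite mulr_sumr; apply: ler_sum => i _.
have := ler_norm (tnth p i - tnth p' i); have := normr_ge0 (tnth p i - tnth p' i).
have := kmin i; have := osc i k; nra.
Qed.

(** Convexity from duality: the optimal pair at [xbar] is feasible at every [x k], and its dual
    value is affine in the first marginal. *)
Lemma OT_average C (N : nat) (x : 'I_N -> n.-tuple R) (xbar q : n.-tuple R) :
  cost_matrix C -> simplex R n q ->
  (forall k, simplex R n (x k)) -> simplex R n xbar ->
  (forall i, tnth xbar i = N%:R^-1 * \sum_(k < N) tnth (x k) i) ->
  (exists u v, dual_optimal C xbar q u v) -> (0 < N)%N ->
  OT C xbar q <= N%:R^-1 * \sum_(k < N) OT C (x k) q.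
Proof.
move=> cC sq sx sxb xbE [u [v uv]] N0; rewrite (OT_dual cC sxb sq uv).
have [fuv _] := uv.
have Nr : (N%:R : R) != 0 by rewrite pnatr_eq0 -lt0n.
have -> : dot u xbar + dot v q = N%:R^-1 * \sum_(k < N) (dot u (x k) + dot v q).
  rewrite big_split/= sumr_const card_ord -(mulr_natl (dot v q)) mulrDr mulKf//.
  congr (_ + _); rewrite /dot exchange_big/= mulr_sumr; apply: eq_bigr => i _.
  by rewrite xbE -mulr_sumr; ring.
by rewrite ler_wpM2l ?invr_ge0// ler_sum// => k _; exact: OT_ge_dual.
Qed.

End transport_duality.

(** * Elementary inequalities for the exponential *)

Section exponential_bounds.
Context (R : realType).
Implicit Types x : R.

Lemma expR_le_quadratic x : x <= 1 -> expR x <= 1 + x + 2 * x ^+ 2.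
Proof.
move=> x1; set e := expR (x / 2).
have -> : expR x = e ^+ 2 by rewrite /e -expRM_natr; congr expR; field.
have e0 : 0 < e by exact: expR_gt0.
have y0 : 0 < 1 - x / 2 by lra.
have ey : e * (1 - x / 2) <= 1.
  have eV : e * expR (- (x / 2)) = 1 by rewrite expRN divff ?gt_eqF.
  rewrite -[X in _ <= X]eV; apply: ler_wpM2l; first exact: ltW.
  exact: expR_ge1Dx.
have : e ^+ 2 * (1 - x / 2) ^+ 2 <= 1.
  by rewrite -exprMn expr_le1// ?mulr_ge0 ?ltW.
(* As [expR x] is at most the inverse of [(1 - x / 2) ^+ 2], it remains to see that the quadratic
   times this square is at least 1; the excess factors with a visible sign for [x <= 1]. *)
have id1 : (1 + x + 2 * x ^+ 2) * (1 - x / 2) ^+ 2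
    - x ^+ 2 / 4 * ((1 - x) * (5 - 2 * x)) = 1 by field.
have : 0 <= x ^+ 2 / 4 * ((1 - x) * (5 - 2 * x)).
  by apply: mulr_ge0; [rewrite divr_ge0 ?sqr_ge0|apply: mulr_ge0; lra].
move=> h1 h2; rewrite -(@ler_pM2r _ ((1 - x / 2) ^+ 2)) ?exprn_gt0//.
by apply: (le_trans h2); rewrite -[X in X <= _]id1 lerBlDr lerDl.
Qed.

(** Isolating the linear term is the point: it averages to zero for a centred variable, which yields
    Hoeffding-type bounds with a cruder constant. *)
Lemma expR_le_gauss x : expR x <= x + expR (2 * x ^+ 2).
Proof.
have := expR_ge1Dx (2 * x ^+ 2).
have [/expR_le_quadratic|x1 _] := leP x 1; first lra.
have : expR x <= expR (2 * x ^+ 2) by rewrite ler_expR; nra.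
lra.
Qed.

End exponential_bounds.

(** * Deterministic regret of exponential weights *)

Section mirror_descent.
Context (R : realType) (n : nat).
Implicit Types (p q u x : n.-tuple R).

(** Hoeffding's bound for the coordinate of [u] drawn with law [p], whose mean is [dot u p]. It
    controls the normaliser of a mirror descent step. *)
Lemma simplex_exp_moment p u (eta M : R) : simplex R n p ->
  (forall i j, tnth u i - tnth u j <= M) ->
  \sum_(i < n) tnth p i * expR (- eta * tnth u i) <=
  expR (- (eta * dot u p) + 2 * eta ^+ 2 * M ^+ 2).
Proof.
move=> [p0 p1] osc; set m := dot u p.
have dev i : `|tnth u i - m| <= M.
  have mE : tnth u i - m = \sum_j tnth p j * (tnth u i - tnth u j).
    under eq_bigr do rewrite mulrBr; rewrite sumrB -mulr_suml p1 mul1r.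
    by congr (_ - _); apply: eq_bigr => j _; rewrite mulrC.
  have ME : M = \sum_j tnth p j * M by rewrite -mulr_suml p1 mul1r.
  rewrite mE ler_norml [X in - X <= _]ME [X in _ && (_ <= X)]ME -sumrN.
  apply/andP; split; apply: ler_sum => j _; last by rewrite ler_wpM2l.
  by rewrite -mulrN ler_wpM2l// lerNl opprB.
rewrite expRD.
have -> : \sum_i tnth p i * expR (- eta * tnth u i) =
    expR (- (eta * m)) * \sum_i tnth p i * expR (- eta * (tnth u i - m)).
  rewrite mulr_sumr; apply: eq_bigr => i _; rewrite mulrCA -expRD.
  by congr (_ * expR _); ring.
rewrite ler_pM2l ?expR_gt0//.
(* A linear term of zero [p]-mean is inserted so that [expR_le_gauss] applies to each coordinate. *)
have -> : expR (2 * eta ^+ 2 * M ^+ 2) =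
    \sum_i tnth p i * (- eta * (tnth u i - m) + expR (2 * eta ^+ 2 * M ^+ 2)).
  under [RHS]eq_bigr do rewrite mulrDr; rewrite big_split/= -mulr_suml p1 mul1r.
  rewrite [X in _ = X + _](_ : _ = 0) ?add0r//.
  transitivity (- eta * \sum_i (tnth u i * tnth p i - tnth p i * m)).
    by rewrite mulr_sumr; apply: eq_bigr => i _; ring.
  by rewrite sumrB -mulr_suml p1 mul1r subrr mulr0.
apply: ler_sum => i _; rewrite ler_wpM2l//.
apply: le_trans (expR_le_gauss _) _; rewrite lerD2l ler_expR -mulrA.
rewrite ler_pM2l// exprMn sqrrN ler_wpM2l ?sqr_ge0//.
by rewrite -real_normK ?num_real// lerXn2r ?nnegrE ?(le_trans _ (dev i)).
Qed.

Variables (g : n.-tuple R -> n.-tuple R -> n.-tuple R) (eta : R).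
Variable q : nat -> n.-tuple R.
Hypothesis n_gt0 : (0 < n)%N.

Lemma uniform_simplex : simplex R n (uniform R n).
Proof.
split=> [i|]; first by rewrite tnth_mktuple invr_ge0.
under eq_bigr do rewrite tnth_mktuple.
by rewrite sumr_const card_ord -[LHS]mulr_natl divff// pnatr_eq0 -lt0n.
Qed.

Lemma smd_norm_gt0 p x : (forall i, 0 < tnth p i) ->
  0 < \sum_(j < n) tnth p j * expR (- eta * tnth x j).
Proof.
move=> pgt0; rewrite (bigD1 (Ordinal n_gt0))//= ltr_pwDl//.
  by rewrite mulr_gt0 ?expR_gt0.
by apply: sumr_ge0 => j _; rewrite mulr_ge0 ?expR_ge0 ?ltW.
Qed.

Lemma smd_iter_gt0 k i : 0 < tnth (smd_iter g eta q k) i.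
Proof.
elim: k i => [|k IH] i /=; first by rewrite tnth_mktuple invr_gt0 ltr0n.
by rewrite tnth_mktuple divr_gt0 ?mulr_gt0 ?expR_gt0// smd_norm_gt0.
Qed.

Lemma smd_iter_simplex k : simplex R n (smd_iter g eta q k).
Proof.
case: k => [|k]; first exact: uniform_simplex.
split => [i|/=]; first exact/ltW/smd_iter_gt0.
under eq_bigr do rewrite tnth_mktuple.
rewrite -mulr_suml divff// gt_eqF// smd_norm_gt0// => i; exact: smd_iter_gt0.
Qed.

Let p k := smd_iter g eta q k.
Let u k := g (p k) (q k).

(* The exponential weight of a coordinate never exceeds 1, whereas it is at   *)
(* least that of the cumulative regret against this coordinate.               *)
Lemma smd_regret (M : R) (N : nat) x : simplex R n x ->
  (forall k, (k < N)%N -> forall i j, tnth (u k) i - tnth (u k) j <= M) ->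
  eta * \sum_(k < N) (dot (u k) (p k) - dot (u k) x) <=
  ln n%:R + 2 * N%:R * eta ^+ 2 * M ^+ 2.
Proof.
move=> [x0 x1] osc.
have coord i : eta * \sum_(k < N) (dot (u k) (p k) - tnth (u k) i)
    - 2 * N%:R * eta ^+ 2 * M ^+ 2 <= ln n%:R.
  have low m : (m <= N)%N -> n%:R^-1 * expR (eta * \sum_(k < m)
      (dot (u k) (p k) - tnth (u k) i) - 2 * m%:R * eta ^+ 2 * M ^+ 2) <= tnth (p m) i.
    elim: m => [_|m IH mN].
      by rewrite big_ord0 !(mulr0, mul0r) subrr expR0 mulr1 tnth_mktuple.
    rewrite /p /= tnth_mktuple -/(p m) -/(u m) ler_pdivlMr; last first.
      by rewrite smd_norm_gt0// => j; exact: smd_iter_gt0.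
    apply: le_trans (ler_wpM2l _ (simplex_exp_moment eta (smd_iter_simplex m) (osc m mN))) _.
      by rewrite mulr_ge0 ?invr_ge0 ?expR_ge0.
    apply: le_trans (ler_wpM2r (expR_ge0 _) (IH (ltnW mN))).
    rewrite -!mulrA ler_pM2l ?invr_gt0 ?ltr0n// -!expRD ler_expR big_ord_recr/= -natr1.
    rewrite le_eqVlt; apply/orP; left; apply/eqP; rewrite -/(p m) -/(u m); ring.
  have := le_trans (low N (leqnn _)) (simplex_le1 i (smd_iter_simplex N)).
  rewrite mulrC ler_pdivrMr ?ltr0n// mul1r -{1}[n%:R]lnK ?posrE ?ltr0n//.
  by rewrite ler_expR.
(* The regret is affine in the comparator, so averaging the bounds for single coordinates with
   weights [x] suffices. *)
have -> : \sum_(k < N) (dot (u k) (p k) - dot (u k) x) =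
    \sum_i tnth x i * \sum_(k < N) (dot (u k) (p k) - tnth (u k) i).
  under [RHS]eq_bigr do rewrite mulr_sumr; rewrite exchange_big/=.
  apply: eq_bigr => k _; under [RHS]eq_bigr do rewrite mulrBr.
  rewrite sumrB -mulr_suml x1 mul1r; congr (_ - _).
  by apply: eq_bigr => i _; rewrite mulrC.
rewrite -lerBlDr.
have -> : ln n%:R = \sum_i tnth x i * ln n%:R by rewrite -mulr_suml x1 mul1r.
have -> : 2 * N%:R * eta ^+ 2 * M ^+ 2 = \sum_i tnth x i * (2 * N%:R * eta ^+ 2 * M ^+ 2).
  by rewrite -mulr_suml x1 mul1r.
rewrite mulr_sumr -sumrB; apply: ler_sum => i _.
by rewrite mulrCA -mulrBr ler_wpM2l.
Qed.

End mirror_descent.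

(** * Integration against an independent pair *)

Section independent_pair.
Context (R : realType) (d d1 d2 : measure_display) (T : measurableType d)
  (S : measurableType d1) (U : measurableType d2).
Variables (Pr : probability T R) (P : probability U R).

(** The hypothesis on rectangles identifies the joint law of [Z] and [Y] with the product of the law
    of [Z] and [P]; Tonelli's theorem then integrates out [Y] first. *)
Lemma independent_tonelli (Z : T -> S) (Y : T -> U) (f : S * U -> \bar R) :
  measurable_fun [set: T] Z -> measurable_fun [set: T] Y ->
  (forall A B, measurable A -> measurable B ->
    Pr (Z @^-1` A `&` Y @^-1` B) = (Pr (Z @^-1` A) * P B)%E) ->
  measurable_fun setT f -> (forall z, (0 <= f z)%E) ->
  (\int[Pr]_w f (Z w, Y w) = \int[Pr]_w \int[P]_u f (Z w, u))%E.
Proof.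
move=> mZ mY ind mf f0.
pose Zm : {mfun T >-> S} := mfun_Sub (mem_set mZ).
pose ZY : {mfun T >-> (S * U)%type} := mfun_Sub (mem_set (measurable_fun_pair mZ mY)).
have -> : (\int[Pr]_w f (Z w, Y w) = \int[distribution Pr ZY]_z f z)%E.
  by rewrite ge0_integral_distribution.
rewrite (@eq_measure_integral _ _ _ _ (distribution Pr Zm \x P)%E); last first.
  move=> A mA _; apply/esym.
  apply: (@product_measure_unique _ _ _ _ _ (distribution Pr Zm) P
    (distribution Pr ZY)) => // B C; exact: ind.
rewrite fubini_tonelli1// ge0_integral_distribution//.
- exact: measurable_fun_fubini_tonelli_F.
- by move=> x; apply: integral_ge0 => u _.
Qed.

End independent_pair.

Lemma bounded_integrable (R : realType) (d : measure_display)
    (U : measurableType d) (P : probability U R) (f : U -> R) (B : R) :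
  measurable_fun [set: U] f -> (forall u, `|f u| <= B) ->
  P.-integrable [set: U] (EFin \o f).
Proof.
move=> mf fB; apply: measurable_bounded_integrable => //.
  by rewrite (le_lt_trans (probability_le1 _ _))// ltry.
exists B; split; first exact: num_real.
by move=> D BD /= u _; exact: le_trans (fB u) (ltW BD).
Qed.

(** * Exponential moments of bounded centred variables *)

Section subgaussian.
Context (R : realType) (d : measure_display) (U : measurableType d).
Variable P : probability U R.

Lemma centered_exp_moment (f : U -> R) (lam B : R) :
  measurable_fun [set: U] f -> (forall u, `|f u| <= B) ->
  (\int[P]_u (f u)%:E = 0)%E ->
  (\int[P]_u (expR (lam * f u))%:E <= (expR (2 * lam ^+ 2 * B ^+ 2))%:E)%E.
Proof.
move=> mf fB f0.
have intf : P.-integrable [set: U] (EFin \o f) by exact: bounded_integrable fB.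
apply: (@le_trans _ _ (\int[P]_u (lam%:E * (f u)%:E +
    (expR (2 * lam ^+ 2 * B ^+ 2))%:E)))%E.
  apply: ge0_le_integral => //.
  - by apply/measurable_EFinP; do 2 apply: measurableT_comp => //.
  - apply: emeasurable_funD => //; apply: emeasurable_funM => //.
    exact/measurable_EFinP.
  - move=> u _; rewrite -EFinM -EFinD lee_fin.
    apply: le_trans (expR_le_gauss _) _; rewrite lerD2l ler_expR -mulrA.
    rewrite ler_pM2l// exprMn ler_wpM2l ?sqr_ge0//.
    by rewrite -[X in X <= _]real_normK ?num_real// lerXn2r ?nnegrE ?(le_trans _ (fB u)).
rewrite integralD//; last 2 first.
- exact: integrableZl.
- exact: finite_measure_integrable_cst.
by rewrite integralZl// f0 mule0 add0e integral_cst// [X in (_ * X)%E]probability_setT mule1.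
Qed.

End subgaussian.

(** * Filtration of the samples and concentration of adapted sums *)

Section adapted_process.
Context (R : realType) (d dU dV : measure_display) (T : measurableType d)
  (U : measurableType dU) (V : measurableType dV).
Variables (Pr : probability T R) (P : probability U R).
Variables (X : nat -> T -> U) (N : nat).
Hypothesis mX : forall k, measurable_fun [set: T] (X k).
Hypothesis lawX : forall k A, (k < N)%N -> measurable A -> Pr (X k @^-1` A) = P A.
Hypothesis indepX : forall A : nat -> set U, (forall k, measurable (A k)) ->
  Pr [set w | forall k, (k < N)%N -> A k (X k w)] =
  (\prod_(k < N) Pr (X k @^-1` A k))%E.

(* Cylinder sets of the first k samples; they generate the k-th sigma-algebra *)
(* of the filtration.                                                         *)
Definition history (k : nat) : set (set T) :=
  [set E | exists2 A : nat -> set U, (forall s, measurable (A s)) &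
           E = [set w | forall s, (s < k)%N -> A s (X s w)]].

Lemma history_measurable k : history k `<=` measurable.
Proof.
move=> _ [A mA ->].
rewrite (_ : [set _ | _] =
    \bigcap_s (if (s < k)%N then X s @^-1` A s else setT)).
  apply: bigcapT_measurable => s; case: ifP => // _.
  by rewrite -[_ @^-1` _]setTI; exact: mX.
apply/seteqP; split => [w Aw s _|w Aw s sk]; first by case: ifP => // /Aw.
by have := Aw s I; rewrite sk.
Qed.

Lemma history_setI k : setI_closed (history k).
Proof.
move=> _ _ [A mA ->] [B mB ->]; exists (fun s => A s `&` B s).
  by move=> s; exact: measurableI.
apply/seteqP; split => [w [Aw Bw] s sk|w AB]; first by split; [exact: Aw|exact: Bw].
by split => s /AB[].
Qed.

Lemma history_setT k : history k setT.
Proof. by exists (fun=> setT) => //; apply/seteqP; split. Qed.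

Lemma history_mono k l : (k <= l)%N -> history k `<=` history l.
Proof.
move=> kl _ [A mA ->]; exists (fun s => if (s < k)%N then A s else setT).
  by move=> s; case: ifP.
apply/seteqP; split => [w Aw s _|w Aw s sk]; first by case: ifP => // /Aw.
by have := Aw s (leq_trans sk kl); rewrite sk.
Qed.

Lemma history_sample s k : (s < k)%N ->
  measurable_fun [set: g_sigma_algebraType (history k)]
    (X s : g_sigma_algebraType (history k) -> U).
Proof.
move=> sk _ B mB; rewrite setTI; apply: sub_sigma_algebra.
exists (fun r => if r == s then B else setT); first by move=> r; case: ifP.
apply/seteqP; split => [w Bw r _|w /(_ s sk)]; last by rewrite eqxx.
by have [->|] := eqVneq r s.
Qed.

Lemma history_fun_mono k l (d' : measure_display) (W : measurableType d')
    (f : T -> W) : (k <= l)%N ->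
  measurable_fun [set: g_sigma_algebraType (history k)]
    (f : g_sigma_algebraType (history k) -> W) ->
  measurable_fun [set: g_sigma_algebraType (history l)]
    (f : g_sigma_algebraType (history l) -> W).
Proof.
move=> kl mf _ B mB; apply: (sub_sigma_algebra2 (history_mono kl)).
exact: mf.
Qed.

Lemma history_fun_measurable k (d' : measure_display) (W : measurableType d')
    (f : T -> W) :
  measurable_fun [set: g_sigma_algebraType (history k)]
    (f : g_sigma_algebraType (history k) -> W) ->
  measurable_fun [set: T] f.
Proof.
move=> mf _ B mB; have := mf measurableT B mB.
apply: smallest_sub; last exact: history_measurable.
exact: sigma_algebra_measurable.
Qed.

(** As functions of [E], both sides are finite measures. They agree on cylinders by [indepX], and
    cylinders form a generating family closed under intersection. *)
Lemma history_independent k (E : set T) (B : set U) : (k < N)%N ->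
  <<s history k >> E -> measurable B ->
  Pr (E `&` X k @^-1` B) = (Pr E * P B)%E.
Proof.
move=> kN sE mB.
have mXB : measurable (X k @^-1` B) by rewrite -[_ @^-1` _]setTI; exact: mX.
have PBfin : P B \is a fin_num by rewrite fin_num_measure.
pose r := NngNum (fine_ge0 (measure_ge0 P B)).
have rE (x : \bar R) : ((r%:num)%:E * x = x * P B)%E by rewrite /= fineK// muleC.
(* Both sides are presented as values of measures, a restriction and a scaling of [Pr], so that
   uniqueness applies. *)
rewrite -rE -[LHS]/(mrestr Pr mXB E) -[RHS]/(mscale r Pr E).
apply: (g_sigma_algebra_measure_unique (history k) (@history_measurable k)
  (fun=> setT) (fun=> @history_setT k)) => //.
- by rewrite bigcup_const.
- exact: history_setI.
- move=> _ [A mA ->]; rewrite -[RHS]/((r%:num)%:E * Pr _)%E rE -[LHS]/(Pr (_ `&` X k @^-1` B)).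
  (* Padding with [setT] from index [k] on, and placing [B] at index [k], turns both events into
     cylinders over all [N] samples whose products differ in one factor. *)
  pose A' s := if (s < k)%N then A s else setT.
  pose A'' s := if s == k then B else A' s.
  have mA' s : measurable (A' s) by rewrite /A'; case: ifP.
  have mA'' s : measurable (A'' s) by rewrite /A''; case: ifP.
  have -> : [set w | forall s, (s < k)%N -> A s (X s w)] =
      [set w | forall s, (s < N)%N -> A' s (X s w)].
    apply/seteqP; split => [w Aw s _|w Aw s sk].
      by rewrite /A'; case: ifP => // /Aw.
    by have := Aw s (ltn_trans sk kN); rewrite /A' sk.
  have -> : [set w | forall s, (s < N)%N -> A' s (X s w)] `&` X k @^-1` B =
      [set w | forall s, (s < N)%N -> A'' s (X s w)].
    apply/seteqP; split => [w [Aw Bw] s sN|w Aw].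
      by rewrite /A''; case: ifPn => [/eqP ->//|_]; exact: Aw.
    split => [s sN|]; last by have := Aw k kN; rewrite /A'' eqxx.
    have := Aw s sN; rewrite /A''; case: ifPn => // /eqP -> _.
    by rewrite /A' ltnn.
  rewrite !indepX// (bigD1 (Ordinal kN))//= [in RHS](bigD1 (Ordinal kN))//=.
  have [-> ->] : A'' k = B /\ A' k = setT by rewrite /A'' eqxx /A' ltnn.
  rewrite lawX// preimage_setT probability_setT mul1e muleC.
  congr (_ * _)%E; apply: eq_bigr => s sk; rewrite /A'' ifF//.
  by apply/negbTE; move: sk; rewrite -val_eqE.
- move=> _; apply: (@le_lt_trans _ _ 1%E); last exact: ltry.
  by apply: probability_le1; exact: measurableI.
Qed.

Variable p : nat -> T -> V.
Hypothesis adapted : forall k, (k < N)%N ->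
  measurable_fun [set: g_sigma_algebraType (history k)]
    (p k : g_sigma_algebraType (history k) -> V).
Variables (phi : V * U -> R) (B : R).
Hypothesis mphi : measurable_fun setT phi.
Hypothesis phiB : forall vu, `|phi vu| <= B.
Hypothesis phi0 : forall v, (\int[P]_u (phi (v, u))%:E = 0)%E.

Let Sum k w := \sum_(s < k) phi (p s w, X s w).

Lemma adapted_sum_history k : (k <= N)%N ->
  measurable_fun [set: g_sigma_algebraType (history k)]
    (Sum k : g_sigma_algebraType (history k) -> R).
Proof.
move=> kN; apply: measurable_sum => s.
apply: (@measurableT_comp _ _ _ _ _ _ phi) => //.
apply: measurable_fun_pair; last exact: history_sample.
by apply: (@history_fun_mono s) => //; [exact: ltnW|apply: adapted; exact: leq_trans kN].
Qed.

Lemma adapted_sum_measurable k : (k <= N)%N -> measurable_fun [set: T] (Sum k).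
Proof. by move=> kN; apply: (@history_fun_measurable k); exact: adapted_sum_history. Qed.

(** Induction on [k]: with the past frozen, the newest increment is centred and bounded by [B], so
    integrating over its sample alone costs one more factor [expR c]. No conditional expectation is
    formed. *)
Lemma adapted_exp_moment (lam : R) k : (k <= N)%N ->
  (\int[Pr]_w (expR (lam * Sum k w))%:E <=
   (expR (k%:R * (2 * lam ^+ 2 * B ^+ 2)))%:E)%E.
Proof.
set c := 2 * lam ^+ 2 * B ^+ 2.
elim: k => [_|k IH kN].
  rewrite /Sum mul0r expR0; under eq_integral do rewrite big_ord0 mulr0 expR0.
  by rewrite integral_cst// [X in (_ * X)%E]probability_setT mule1.
pose Z w := (p k w, expR (lam * Sum k w)).
have mZ : measurable_fun [set: g_sigma_algebraType (history k)]
    (Z : g_sigma_algebraType (history k) -> V * R).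
  apply: measurable_fun_pair; first exact: adapted.
  by do 2 apply: measurableT_comp => //; apply: adapted_sum_history; exact: ltnW.
(* The absolute value makes [f] nonnegative everywhere, as Tonelli requires; along [Z] that
   component is an exponential, so nothing changes. *)
pose f (zu : (V * R) * U) := (`|zu.1.2| * expR (lam * phi (zu.1.1, zu.2)))%:E.
have mf : measurable_fun setT f.
  apply/measurable_EFinP; apply: measurable_funM.
    by apply: measurableT_comp => //; exact: measurableT_comp.
  do 2 apply: measurableT_comp => //; apply: measurableT_comp => //.
  by apply: measurable_fun_pair => //; exact: measurableT_comp.
have -> : (\int[Pr]_w (expR (lam * Sum k.+1 w))%:E = \int[Pr]_w f (Z w, X k w))%E.
  apply: eq_integral => w _; rewrite /f/= ger0_norm ?expR_ge0//.
  by rewrite -expRD -mulrDr /Sum big_ord_recr.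
rewrite (@independent_tonelli _ _ _ _ _ _ _ Pr P Z (X k) f)//; last 3 first.
- exact: history_fun_measurable mZ.
- move=> A C mA mC; apply: history_independent => //.
  by have := mZ measurableT A mA; rewrite setTI.
- by move=> zu; rewrite lee_fin mulr_ge0 ?expR_ge0.
apply: (@le_trans _ _ (\int[Pr]_w ((expR c)%:E * (expR (lam * Sum k w))%:E))%E).
  have mS := adapted_sum_measurable (ltnW kN).
  apply: ge0_le_integral => //.
  - by move=> w _; apply: integral_ge0 => u _; rewrite lee_fin mulr_ge0 ?expR_ge0.
  - have mF := @measurable_fun_fubini_tonelli_F _ _ _ _ R P f mf.
    apply: (@measurableT_comp _ _ _ _ _ _ (fubini_F P f) _ Z).
      by apply: mF => zu; rewrite lee_fin mulr_ge0 ?expR_ge0.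
    exact: history_fun_measurable mZ.
  - apply: emeasurable_funM => //; apply/measurable_EFinP.
    by do 2 apply: measurableT_comp => //.
  - move=> w _; rewrite /f/= ger0_norm ?expR_ge0//.
    have mphiw : measurable_fun [set: U] (fun u => phi (p k w, u)).
      exact: measurable_fun_pair2.
    under eq_integral do rewrite EFinM.
    rewrite ge0_integralZl//; last first.
      by apply/measurable_EFinP; do 2 apply: measurableT_comp => //.
    rewrite muleC lee_pmul2r// ?lte_fin ?expR_gt0//.
    exact: centered_exp_moment.
rewrite ge0_integralZl//; last first.
  apply/measurable_EFinP; do 2 apply: measurableT_comp => //.
  exact/adapted_sum_measurable/ltnW.
apply: le_trans (lee_wpmul2l _ (IH (ltnW kN))) _; first by rewrite lee_fin expR_ge0.
by rewrite -EFinM lee_fin -expRD -natr1 mulrDl mul1r addrC.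
Qed.

Lemma adapted_concentration (lam t : R) : 0 < lam ->
  (Pr [set w | (t <= Sum N w)%R] <=
   (expR (N%:R * (2 * lam ^+ 2 * B ^+ 2) - lam * t))%:E)%E.
Proof.
move=> lam0.
pose S : {RV Pr >-> R} := mfun_Sub (mem_set (adapted_sum_measurable (leqnn N))).
apply: le_trans (chernoff S t lam0) _.
rewrite /mmt_gen_fun unlock.
apply: (@le_trans _ _ ((expR (N%:R * (2 * lam ^+ 2 * B ^+ 2)))%:E *
    (expR (- (lam * t)))%:E)%E).
  rewrite lee_pmul2r ?lte_fin ?expR_gt0//.
  under eq_integral do rewrite /= mulrC.
  exact: (adapted_exp_moment lam (leqnn N)).
by rewrite -EFinM -expRD.
Qed.

End adapted_process.

(** * Measurability of the transport cost and of the iterates *)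

Section measurability.
Context (R : realType) (n : nat).
Implicit Types (C : 'M[R]_n) (p q u v : n.-tuple R).

Lemma measurable_simplex : measurable (simplex R n).
Proof.
rewrite (_ : simplex R n =
    (\bigcap_(i in [set: 'I_n]) ((@tnth n R ^~ i) @^-1` `[0, +oo[))
    `&` ((fun p => \sum_i tnth p i) @^-1` [set 1])).
  apply: measurableI.
    apply: fin_bigcap_measurable => // i _; rewrite -[_ @^-1` _]setTI.
    by apply: measurable_tnth => //; exact: measurable_itv.
  rewrite -[_ @^-1` _]setTI; apply: measurable_sum => // i.
  exact: measurable_tnth.
apply/seteqP; split => [p [p0 p1]|p [p0 p1]]; split => // i.
  by move=> _ /=; rewrite in_itv/= p0.
by have := p0 i I; rewrite /= in_itv/= andbT.
Qed.

Lemma measurable_dot (d : measure_display) (T : measurableType d)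
    (f : T -> n.-tuple R) u : measurable_fun [set: T] f ->
  measurable_fun [set: T] (fun w => dot u (f w)).
Proof.
move=> mf; apply: measurable_sum => i; apply: measurable_funM => //.
by move/measurable_fun_tnthP: mf; exact.
Qed.

(** Rounding is downwards so that rational approximations of a dual feasible pair remain
    feasible. *)
Lemma ratr_tuple_approx u (e : R) : 0 < e ->
  exists a : n.-tuple rat, forall i,
    tnth u i - e <= ratr (tnth a i) <= tnth u i.
Proof.
move=> e0.
have ex i : exists a : rat, ratr a \in `]tnth u i - e, tnth u i[.
  by apply: rat_in_itvoo; rewrite ltrBlDr ltrDl.
exists [tuple sval (cid (ex i)) | i < n] => i; rewrite tnth_mktuple.
by case: cid => a /=; rewrite in_itv/= => /andP[/ltW -> /ltW ->].
Qed.

(* By duality {OT > a} is a countable union over rational dual pairs.         *)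
Lemma measurable_OT C : cost_matrix C ->
  (forall p q, simplex R n p -> simplex R n q ->
     exists u v, dual_optimal C p q u v) ->
  measurable_fun (simplex R n `*` simplex R n)
    (fun pq : n.-tuple R * n.-tuple R => OT C pq.1 pq.2).
Proof.
move=> cC dual mD.
apply: (measurability _ (RGenOInfty.measurableE R)) => // _ [_ [a ->] <-].
pose rt (x : n.-tuple rat) : n.-tuple R := [tuple ratr (tnth x i) | i < n].
rewrite (_ : _ `&` _ = (simplex R n `*` simplex R n) `&`
    \bigcup_(uv : n.-tuple rat * n.-tuple rat)
    (if `[< dual_feasible C (rt uv.1) (rt uv.2) >] then
       (fun pq : n.-tuple R * n.-tuple R =>
          dot (rt uv.1) pq.1 + dot (rt uv.2) pq.2) @^-1` `]a, +oo[
     else set0)).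
  apply: measurableI => //; apply: countable_bigcupT_measurable => [|uv].
    exact: countableP.
  case: ifPn => // _; rewrite -[_ @^-1` _]setTI.
  have md : measurable_fun setT (fun pq : n.-tuple R * n.-tuple R =>
      dot (rt uv.1) pq.1 + dot (rt uv.2) pq.2).
    by apply: measurable_funD; exact: measurable_dot.
  by apply: md => //; exact: measurable_itv.
apply/seteqP; split => -[p q] [[/= sp sq]].
  rewrite /= in_itv/= andbT => aOT; split => //.
  have [u [v uv]] := dual _ _ sp sq; have [fuv _] := uv.
  rewrite (OT_dual cC sp sq uv) in aOT.
  (* Each of the two potentials loses at most [e], so the rational pair keeps at least half of the
     excess over [a]. *)
  pose e := (dot u p + dot v q - a) / 4.
  have e0 : 0 < e by rewrite /e; lra.
  have [u' u'E] := ratr_tuple_approx u e0.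
  have [v' v'E] := ratr_tuple_approx v e0.
  exists (u', v') => //.
  rewrite /= asboolT; last first.
    move=> i j; rewrite !tnth_mktuple.
    by have := u'E i; have := v'E j; have := fuv i j; lra.
  have low (x : n.-tuple R) (x' : n.-tuple rat) r : simplex R n r ->
      (forall i, tnth x i - e <= ratr (tnth x' i) <= tnth x i) ->
      dot x r - e <= dot (rt x') r.
    move=> [r0 r1] xE.
    have -> : dot x r - e = \sum_i (tnth x i - e) * tnth r i.
      by under [RHS]eq_bigr do rewrite mulrBl; rewrite sumrB -mulr_sumr r1 mulr1.
    apply: ler_sum => i _; rewrite tnth_mktuple ler_wpM2r//.
    by case/andP: (xE i).
  have := low _ _ _ sp u'E; have := low _ _ _ sq v'E.
  rewrite /= in_itv/= andbT; move: e0; rewrite /e; lra.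
move=> [[u v] _]; case: ifPn => // /asboolP fuv /=; rewrite !in_itv/= !andbT => h.
by split => //; exact: lt_le_trans h (OT_ge_dual sp sq fuv).
Qed.

Variables (d : measure_display) (T : measurableType d) (X : nat -> T -> n.-tuple R).
Variables (g : n.-tuple R -> n.-tuple R -> n.-tuple R) (eta : R).
Hypothesis n_gt0 : (0 < n)%N.
Hypothesis mg : measurable_fun (simplex R n `*` simplex R n)
  (fun pq : n.-tuple R * n.-tuple R => g pq.1 pq.2).

(** Only the first [k] samples are constrained, so the lemma serves both the ambient sigma-algebra
    and the one generated by [history k]. *)
Lemma measurable_smd_iter k :
  (forall s, (s < k)%N -> measurable_fun [set: T] (X s)) ->
  (forall s w, (s < k)%N -> simplex R n (X s w)) ->
  measurable_fun [set: T] (fun w => smd_iter g eta (X ^~ w) k).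
Proof.
elim: k => [_ _|k IH mX sX] /=; first exact: measurable_cst.
have mp := IH (fun s sk => mX s (ltnW sk)) (fun s w sk => sX s w (ltnW sk)).
have mXk := mX k (leqnn _).
have mgk : measurable_fun [set: T] (fun w => g (smd_iter g eta (X ^~ w) k) (X k w)).
  apply: (measurable_comp _ _ mg (measurable_fun_pair mp mXk)).
    by apply: measurableX; exact: measurable_simplex.
  by move=> _ [w _ <-]; split => /=; [exact: smd_iter_simplex|exact: sX].
have mw i : measurable_fun [set: T] (fun w => tnth (smd_iter g eta (X ^~ w) k) i *
    expR (- eta * tnth (g (smd_iter g eta (X ^~ w) k) (X k w)) i)).
  apply: measurable_funM; first by move/measurable_fun_tnthP: mp; exact.
  apply: measurableT_comp => //; apply: measurable_funM => //.
  by move/measurable_fun_tnthP: mgk; exact.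
apply/measurable_fun_tnthP => i.
(* The normaliser is positive, so dividing by it is multiplying by the exponential of minus its
   logarithm, a composition of measurable maps. *)
rewrite (_ : _ \o _ = (fun w => tnth (smd_iter g eta (X ^~ w) k) i *
    expR (- eta * tnth (g (smd_iter g eta (X ^~ w) k) (X k w)) i) *
    expR (- ln (\sum_j tnth (smd_iter g eta (X ^~ w) k) j *
    expR (- eta * tnth (g (smd_iter g eta (X ^~ w) k) (X k w)) j))))).
  apply: measurable_funM => //; apply: measurableT_comp => //.
  apply: measurable_funN; apply: measurableT_comp; first exact: measurable_ln.
  exact: measurable_sum.
apply/funext => w /=; rewrite tnth_mktuple expRN lnK// posrE smd_norm_gt0//.
by move=> j; exact: smd_iter_gt0.
Qed.

End measurability.

Lemma Rintegral_sum (R : realType) (d : measure_display) (T : measurableType d)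
    (mu : {measure set T -> \bar R}) (I : Type) (r : seq I) (F : I -> T -> R) :
  (forall i, mu.-integrable [set: T] (EFin \o F i)) ->
  \int[mu]_x (\sum_(i <- r) F i x) = \sum_(i <- r) \int[mu]_x F i x.
Proof.
move=> iF; elim: r => [|i r IH].
  by under eq_Rintegral do rewrite big_nil; rewrite Rintegral_cst// mul0r big_nil.
under eq_Rintegral do rewrite big_cons.
rewrite RintegralD// ?IH ?big_cons//.
rewrite (_ : EFin \o _ = fun x => (\sum_(j <- r) (F j x)%:E)%E).
  by apply: integrable_sum => // j _; exact: iF.
by apply/funext => x /=; rewrite sumEFin.
Qed.

(** * High-probability bound for stochastic mirror descent *)

Section smd_probability.
Context (R : realType) (n : nat).
Variables (C : 'M[R]_n) (g : n.-tuple R -> n.-tuple R -> n.-tuple R).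
Variables (P : probability (n.-tuple R) R) (pstar : n.-tuple R).
Hypothesis n_gt0 : (0 < n)%N.
Hypothesis cC : cost_matrix C.
Hypothesis M_gt0 : 0 < max_entry C.
Hypothesis grad : forall p q, simplex R n p -> simplex R n q ->
  OT_gradient C p q (g p q).
Hypothesis mg : measurable_fun (simplex R n `*` simplex R n)
  (fun pq : n.-tuple R * n.-tuple R => g pq.1 pq.2).
Hypothesis sstar : simplex R n pstar.
Implicit Types p q : n.-tuple R.

Let M := max_entry C.
Let S := simplex R n.
(** Extension by zero gives a function that is measurable and bounded on the whole space, as the
    concentration bound requires; it agrees with [OT C] on the simplices. *)
Let OT0 : n.-tuple R * n.-tuple R -> R :=
  (fun pq => OT C pq.1 pq.2) \_ (S `*` S).
Let W0 p := \int[P]_q OT0 (p, q).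

Let dual p q : S p -> S q -> exists u v, dual_optimal C p q u v.
Proof. by move=> sp sq; have [[v uv] _] := grad sp sq; exists (g p q), v. Qed.

Let OT0E p q : S p -> S q -> OT0 (p, q) = OT C p q.
Proof. by move=> sp sq; rewrite /OT0 patchE mem_set. Qed.

Let mOT0 : measurable_fun setT OT0.
Proof.
have mSS : measurable (S `*` S) by apply: measurableX; exact: measurable_simplex.
apply: ((measurable_restrictT (fun pq : n.-tuple R * n.-tuple R => OT C pq.1 pq.2) mSS).1 _).
exact: measurable_OT.
Qed.

Let OT0_bound pq : 0 <= OT0 pq <= M.
Proof.
rewrite /OT0 patchE; case: ifPn => [|_]; last by rewrite lexx ltW.
by rewrite inE => -[s1 s2]; rewrite OT_ge0//= OT_le_max.
Qed.

Let OT0_integrable p : P.-integrable setT (EFin \o (fun q => OT0 (p, q))).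
Proof.
apply: (@bounded_integrable _ _ _ P _ M) => [|q]; first exact: measurable_fun_pair2.
by have /andP[h1 h2] := OT0_bound (p, q); rewrite ger0_norm.
Qed.

Let PT : fine (P setT) = 1.
Proof. by rewrite [P _]probability_setT. Qed.

Let W0_bound p : 0 <= W0 p <= M.
Proof.
apply/andP; split.
  by apply: Rintegral_ge0 => q _; case/andP: (OT0_bound (p, q)).
rewrite -[M]mulr1 -PT -Rintegral_cst//; apply: le_Rintegral => //.
  exact: finite_measure_integrable_cst.
by move=> q _; case/andP: (OT0_bound (p, q)).
Qed.

Let W0E p : S p -> mean_OT C P p = W0 p.
Proof.
move=> sp; rewrite /mean_OT Rintegral_mkcond; apply: eq_Rintegral => q _.
rewrite /OT0 !patchE; have [sq|/negP sq] := boolP (q \in simplex R n).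
  by rewrite mem_set//; split => //; exact: set_mem.
by rewrite ifF//; apply/negbTE/negP; rewrite inE => -[_ /mem_set].
Qed.

Let mW0 : measurable_fun setT W0.
Proof.
rewrite (_ : W0 = fine \o fubini_F P (EFin \o OT0)).
  apply: measurableT_comp; first exact: fine_measurable.
  apply: measurable_fun_fubini_tonelli_F; first exact/measurable_EFinP.
  by move=> pq; rewrite lee_fin; case/andP: (OT0_bound pq).
by apply/funext.
Qed.

Lemma mean_OT_average (N : nat) (x : 'I_N -> n.-tuple R) xbar : (0 < N)%N ->
  (forall k, S (x k)) -> S xbar ->
  (forall i, tnth xbar i = N%:R^-1 * \sum_(k < N) tnth (x k) i) ->
  mean_OT C P xbar <= N%:R^-1 * \sum_(k < N) mean_OT C P (x k).
Proof.
move=> N0 sx sxb xbE; rewrite W0E//; under eq_bigr do rewrite W0E//.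
have iS : P.-integrable setT (EFin \o (fun q => \sum_(k < N) OT0 (x k, q))).
  rewrite (_ : EFin \o _ = fun q => (\sum_(k < N) (OT0 (x k, q))%:E)%E).
    by apply: integrable_sum => // j _; exact: OT0_integrable.
  by apply/funext => q /=; rewrite sumEFin.
rewrite -Rintegral_sum// -RintegralZl//; apply: le_Rintegral => //.
  rewrite (_ : EFin \o _ =
      fun q => ((N%:R^-1)%:E * (\sum_(k < N) OT0 (x k, q))%:E)%E) //.
  exact: integrableZl.
(* For [q] off the simplex the left integrand is 0 and the right one is nonnegative; on the simplex
   this is convexity. *)
move=> q _; have [sq|nsq] := boolP (q \in S); last first.
  rewrite {1}/OT0 patchE ifF; last first.
    by apply/negbTE; apply: contra nsq; rewrite !inE => -[].
  rewrite mulr_ge0 ?invr_ge0// sumr_ge0// => k _.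
  by case/andP: (OT0_bound (x k, q)).
move/set_mem : sq => sq.
rewrite OT0E//; under eq_bigr do rewrite OT0E//.
by apply: OT_average => //; exact: dual.
Qed.

(** The expected excess over [pstar] minus the excess observed on one sample: the martingale
    increment, centred in the sample for each fixed point. *)
Let phi (pq : n.-tuple R * n.-tuple R) :=
  (W0 pq.1 - W0 pstar) - (OT0 pq - OT0 (pstar, pq.2)).

Let mphi : measurable_fun setT phi.
Proof.
apply: measurable_funB; first by apply: measurable_funB => //; exact: measurableT_comp.
apply: measurable_funB => //; apply: (@measurableT_comp _ _ _ _ _ _ OT0) => //.
exact: measurable_fun_pair.
Qed.

Let phiB pq : `|phi pq| <= 2 * M.
Proof.
have := W0_bound pq.1; have := W0_bound pstar; have := OT0_bound pq.
have := OT0_bound (pstar, pq.2); rewrite ler_norml /phi.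
move=> /andP[? ?] /andP[? ?] /andP[? ?] /andP[? ?]; lra.
Qed.

Let phi0 p : (\int[P]_q (phi (p, q))%:E = 0)%E.
Proof.
have iphi : P.-integrable setT (EFin \o (fun q => phi (p, q))).
  by apply: (@bounded_integrable _ _ _ P _ (2 * M)) => //; exact: measurable_fun_pair2.
rewrite -[LHS]fineK; last exact: integrable_fin_num.
congr EFin; rewrite -[LHS]/(\int[P]_q phi (p, q)) /phi /=.
have icst : P.-integrable setT (EFin \o cst (W0 p - W0 pstar)).
  exact: finite_measure_integrable_cst.
have iB : P.-integrable setT (EFin \o (fun q => OT0 (p, q) - OT0 (pstar, q))).
  rewrite (_ : EFin \o _ = (fun q => (OT0 (p, q))%:E - (OT0 (pstar, q))%:E)%E)//.
  exact: (integrableB measurableT (OT0_integrable p) (OT0_integrable pstar)).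
rewrite RintegralB// RintegralB// Rintegral_cst// PT mulr1.
by rewrite subrr.
Qed.

Variable N : nat.
Hypothesis N_gt0 : (0 < N)%N.
Let eta := smd_stepsize C N.

Lemma smd_average_simplex (q : nat -> n.-tuple R) : S (smd_average C g N q).
Proof.
have Nr : (N%:R : R) != 0 by rewrite pnatr_eq0 -lt0n.
split => [i|].
  rewrite tnth_mktuple mulr_ge0 ?invr_ge0// sumr_ge0// => k _.
  exact/ltW/smd_iter_gt0.
under eq_bigr do rewrite tnth_mktuple.
rewrite -mulr_sumr exchange_big/= (eq_bigr (fun=> 1)).
  by rewrite sumr_const card_ord mulVf.
by move=> k _; have [] := smd_iter_simplex g eta q n_gt0 k.
Qed.

(** Put [b = Num.sqrt (2 * ln n%:R)]. The step size satisfies [eta * (M * Num.sqrt N%:R) = b], so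
    the regret bound reads [b ^+ 2 / 2 + 2 * b ^+ 2], and dividing by [eta] gives the factor 5/2. *)
Lemma smd_regret_stepsize (q : nat -> n.-tuple R) :
  (forall k, (k < N)%N -> S (q k)) ->
  \sum_(k < N) (OT C (smd_iter g eta q k) (q k) - OT C pstar (q k)) <=
  5 / 2 * Num.sqrt (2 * ln n%:R) * M * Num.sqrt N%:R.
Proof.
move=> sq; pose p k := smd_iter g eta q k.
have sp k : S (p k) by exact: smd_iter_simplex.
pose u k := g (p k) (q k).
apply: (@le_trans _ _ (\sum_(k < N) (dot (u k) (p k) - dot (u k) pstar))).
  apply: ler_sum => k _.
  have [[v uv] _] := grad (sp k) (sq _ (ltn_ord k)).
  exact: OT_subgradient cC (sp k) sstar (sq _ (ltn_ord k)) uv.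
have s0 : 0 < Num.sqrt (N%:R : R) by rewrite sqrtr_gt0 ltr0n.
(* For [n = 1] the step size is 0 and cannot be divided out, but the simplex is a single point and
   every term vanishes. *)
have [n1|n2] := leqP n 1.
  rewrite big1 => [|k _].
    by rewrite mulr_ge0 ?sqrtr_ge0// mulr_ge0 ?(ltW M_gt0)// mulr_ge0 ?sqrtr_ge0.
  have one (x : n.-tuple R) i : S x -> tnth x i = 1.
    move=> [_ <-]; rewrite (bigD1 i)//= big1 ?addr0// => j /eqP[].
    have zero (l : 'I_n) : val l = 0%N.
      by apply/eqP; rewrite -leqn0 -ltnS (leq_trans (ltn_ord l) n1).
    by apply/val_inj; rewrite !zero.
  rewrite -sumrB big1// => i _.
  by rewrite (one (p k))// (one pstar)// subrr.
have ln0 : 0 < ln (n%:R : R) by rewrite ln_gt0// ltr1n.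
set b := Num.sqrt (2 * ln n%:R); have b0 : 0 < b by rewrite sqrtr_gt0 mulr_gt0.
have bE : b ^+ 2 = 2 * ln n%:R by rewrite sqr_sqrtr// mulr_ge0// ltW.
have sE : Num.sqrt (N%:R : R) ^+ 2 = N%:R by rewrite sqr_sqrtr.
have etaE : eta * (M * Num.sqrt N%:R) = b.
  by rewrite /eta /smd_stepsize -/M -/b divfK// mulf_neq0 ?gt_eqF.
have eta0 : 0 < eta by rewrite divr_gt0 ?mulr_gt0.
have := @smd_regret R n g eta q n_gt0 M N pstar sstar
  (fun k kN => gradient_osc cC (sp k) (smd_iter_gt0 g eta q n_gt0 k)
                 (grad (sp k) (sq k kN))).
rewrite -/p -[\sum_(k < N) _]/(\sum_(k < N) (dot (u k) (p k) - dot (u k) pstar)).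
move: (\sum_(k < N) _) => Reg.
have -> : ln n%:R + 2 * N%:R * eta ^+ 2 * M ^+ 2 = eta * (5 / 2 * b * M * Num.sqrt N%:R).
  have -> : eta * (5 / 2 * b * M * Num.sqrt N%:R) = 5 / 2 * b * (eta * (M * Num.sqrt N%:R)).
    by ring.
  have -> : 2 * N%:R * eta ^+ 2 * M ^+ 2 = 2 * (eta * (M * Num.sqrt N%:R)) ^+ 2.
    by rewrite !exprMn sE; ring.
  rewrite etaE -mulrA -expr2 bE; lra.
by rewrite ler_pM2l.
Qed.

Variables (d : measure_display) (T : measurableType d) (Pr : probability T R).
Variable X : nat -> {RV Pr >-> n.-tuple R}.
Hypothesis iidX : iid_samples N P X.

Let avg w := smd_average C g N (fun k => X k w).

Lemma smd_gap_measurable (t : R) :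
  measurable [set w | mean_OT C P (avg w) - mean_OT C P pstar <= t].
Proof.
have [sX _ _] := iidX.
have mavg : measurable_fun [set: T] avg.
  apply/measurable_fun_tnthP => i.
  rewrite (_ : _ \o _ = (fun w => N%:R^-1 *
      \sum_(k < N) tnth (smd_iter g eta (fun k => X k w) k) i)).
    apply: measurable_funM => //; apply: measurable_sum => k.
    have mk : measurable_fun [set: T] (fun w => smd_iter g eta (fun k => X k w) k).
      apply: (@measurable_smd_iter R n d T X g eta n_gt0 mg) => [s _|s w sk] //.
      exact/sX/(ltn_trans sk).
    by move/measurable_fun_tnthP: mk; exact.
  by apply/funext => w /=; rewrite tnth_mktuple.
rewrite (_ : [set w | _] = (W0 \o avg) @^-1` `]-oo, t + mean_OT C P pstar]).
  rewrite -[_ @^-1` _]setTI.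
  exact: (measurableT_comp mW0 mavg measurableT (measurable_itv _)).
have sa w : S (avg w) by exact: smd_average_simplex.
by apply/seteqP; split => w /=; rewrite in_itv/= lerBlDr (W0E (sa w)).
Qed.

Let Sum w := \sum_(k < N) phi (smd_iter g eta (fun k => X k w) k, X k w).

(** Holds for every outcome: convexity bounds the left side by the summed expected excesses, which
    split into the martingale [Sum] and the empirical excess bounded by the regret. *)
Lemma smd_gap_le w :
  N%:R * (mean_OT C P (avg w) - mean_OT C P pstar) <=
  Sum w + 5 / 2 * Num.sqrt (2 * ln n%:R) * M * Num.sqrt N%:R.
Proof.
have [sX _ _] := iidX.
pose p k := smd_iter g eta (fun k => X k w) k.
have sp k : S (p k) by exact: smd_iter_simplex.
have Nr : (0 : R) < N%:R by rewrite ltr0n.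
have := @mean_OT_average N p (avg w) N_gt0 (fun k => sp k) (smd_average_simplex _)
  (fun i => tnth_mktuple _ _).
rewrite mulrC ler_pdivlMr// mulrC => h.
have := @smd_regret_stepsize (fun k => X k w) (fun k kN => sX k w kN).
suff -> : Sum w = \sum_(k < N) mean_OT C P (p k) - N%:R * mean_OT C P pstar
    - \sum_(k < N) (OT C (p k) (X k w) - OT C pstar (X k w)).
  by rewrite mulrBr -/p; move: h; rewrite -/(p); lra.
have -> : N%:R * mean_OT C P pstar = \sum_(k < N) mean_OT C P pstar.
  by rewrite sumr_const card_ord mulr_natl.
rewrite -!sumrB; apply: eq_bigr => k _.
by rewrite /phi/= !W0E// !OT0E//; exact: sX.
Qed.

(** The iterate of index [k] is computed from the samples of index below [k]. *)
Let adapted k : (k < N)%N ->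
  measurable_fun [set: g_sigma_algebraType (history (fun k => X k : T -> _) k)]
    (fun w : g_sigma_algebraType (history (fun k => X k : T -> _) k) =>
       smd_iter g eta (fun k => X k w) k).
Proof.
move=> kN; have [sX _ _] := iidX.
apply: (@measurable_smd_iter R n _
  (g_sigma_algebraType (history (fun k => X k : T -> _) k))
  (fun k => X k : T -> _) g eta n_gt0 mg).
- by move=> s sk; exact: history_sample.
- by move=> s w sk; apply/sX/(ltn_trans sk).
Qed.

Let mSum (t : R) : measurable [set w | t <= Sum w].
Proof.
have mS : measurable_fun [set: T] Sum.
  exact: (@adapted_sum_measurable R d _ _ T _ _ (fun k => X k : T -> _) N _
    (fun k w => smd_iter g eta (fun k => X k w) k) adapted phi mphi N).
rewrite (_ : [set w | _] = Sum @^-1` `[t, +oo[).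
  by rewrite -[_ @^-1` _]setTI; exact: (mS measurableT _ (measurable_itv _)).
by apply/seteqP; split => w /=; rewrite in_itv/= andbT.
Qed.

Lemma smd_martingale_tail (lam t : R) : 0 < lam ->
  (Pr [set w | (t <= Sum w)%R] <=
   (expR (N%:R * (2 * lam ^+ 2 * (2 * M) ^+ 2) - lam * t))%:E)%E.
Proof.
have [sX lawX indX] := iidX.
exact: (@adapted_concentration R d _ _ T _ _ Pr P (fun k => X k : T -> _) N _
  lawX indX (fun k w => smd_iter g eta (fun k => X k w) k) adapted phi (2 * M)
  mphi phiB phi0).
Qed.

Lemma smd_high_probability (beta : R) : 0 < beta < 1 ->
  with_probability Pr (1 - beta)
    [set w | mean_OT C P (avg w) - mean_OT C P pstar <=
             10 * (M * Num.sqrt (ln (n%:R / beta)) / Num.sqrt N%:R)].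
Proof.
move=> /andP[b0 b1]; split; first exact: smd_gap_measurable.
set L := ln (n%:R / beta); set s := Num.sqrt (N%:R : R).
have n1 : 1 <= (n%:R : R) by rewrite ler1n.
have nb : 1 < n%:R / beta by rewrite ltr_pdivlMr// mul1r (lt_le_trans b1).
have L0 : 0 < L by rewrite ln_gt0.
have s0 : 0 < s by rewrite sqrtr_gt0 ltr0n.
have sE : s ^+ 2 = N%:R by rewrite sqr_sqrtr.
set a := Num.sqrt L; have a0 : 0 < a by rewrite sqrtr_gt0.
have aE : a ^+ 2 = L by rewrite sqr_sqrtr// ltW.
(* This [lam] minimises the Chernoff exponent [8 * N%:R * M ^+ 2 * lam ^+ 2 - lam * t], with value
   [- t ^+ 2 / (32 * N%:R * M ^+ 2)]; the factor 6 makes it [- (9 / 8 * L)], enough for a tail of at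
   most [beta / n%:R]. *)
pose t := 6 * M * s * a; pose lam := t / (16 * M ^+ 2 * N%:R).
have M0 : 0 < M by [].
have t0 : 0 < t by rewrite !mulr_gt0.
have lam0 : 0 < lam by rewrite divr_gt0// !mulr_gt0 ?exprn_gt0 ?ltr0n.
have expo : N%:R * (2 * lam ^+ 2 * (2 * M) ^+ 2) - lam * t = - (9 / 8 * L).
  rewrite /lam /t -aE -sE; field; rewrite ?gt_eqF//.
have tail : (Pr [set w | (t <= Sum w)%R] <= beta%:E)%E.
  apply: le_trans (smd_martingale_tail t lam0) _; rewrite lee_fin expo.
  apply: (@le_trans _ _ (expR (- L))); first by rewrite ler_expR; lra.
  rewrite expRN lnK ?posrE ?divr_gt0 ?ltr0n// invf_div ler_pdivrMr ?ltr0n//.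
  by rewrite ler_peMr// ltW.
apply: (@le_trans _ _ (Pr (~` [set w | t <= Sum w]))).
  rewrite probability_setC// EFinB leeB//.
apply: le_measure; rewrite ?inE; [exact: measurableC|exact: smd_gap_measurable|].
move=> w /= /negP; rewrite -ltNge => Sw.
have Nr : (0 : R) < N%:R by rewrite ltr0n.
rewrite -(ler_pM2l Nr); apply: le_trans (smd_gap_le w) _.
have -> : N%:R * (10 * (M * a / s)) = 10 * M * s * a.
  by rewrite -sE; field; rewrite gt_eqF.
(* The square of 8/5 exceeds 2. The regret thus contributes 5/2 times 8/5, that is 4, which with the
   6 from the martingale makes 10. *)
have ba : Num.sqrt (2 * ln n%:R) <= 8 / 5 * a.
  have a85 : 0 <= 8 / 5 * a by rewrite mulr_ge0// ltW.
  rewrite -(ger0_norm a85) -sqrtr_sqr; apply: ler_wsqrtr.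
  rewrite exprMn aE; have : ln n%:R <= L.
    by rewrite ler_ln ?posrE ?ltr0n ?divr_gt0 ?ltr0n// ler_pdivlMr// ler_piMr// ltW.
  by have := L0; lra.
have : 5 / 2 * Num.sqrt (2 * ln n%:R) * M * s <= 4 * M * s * a.
  have -> : 4 * M * s * a = 5 / 2 * (8 / 5 * a) * M * s by field.
  by rewrite ler_pM2r// ler_pM2r// ler_pM2l.
move: Sw; rewrite /t -/s; lra.
Qed.

End smd_probability.

(** * Correctness and operation counts of the program *)

Section programs.
Context (R : realType).
Local Arguments max_entry_prog : simpl never.
Local Arguments stepsize_prog : simpl never.
Local Arguments sum_prog : simpl never.
Local Arguments vecM : simpl never.

Lemma run_bind (A B : Type) (t : prog R A) (f : A -> prog R B) :
  run (bind t f) = run (f (run t)).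
Proof. by elim: t => [a|m k IH|o x k IH|o x y k IH|x y k IH] /=. Qed.

Lemma ops_bind (A B : Type) (t : prog R A) (f : A -> prog R B) :
  ops (bind t f) = (ops t + ops (f (run t)))%N.
Proof. by elim: t => [a|m k IH|o x k IH|o x y k IH|x y k IH] //=; rewrite IH. Qed.

Lemma run_mapM (I A : Type) (f : I -> prog R A) s :
  run (mapM f s) = [seq run (f i) | i <- s].
Proof. by elim: s => //= i s IH; rewrite !run_bind /= IH. Qed.

Lemma ops_mapM (I A : Type) (f : I -> prog R A) s c :
  (forall i, ops (f i) = c) -> ops (mapM f s) = (size s * c)%N.
Proof. by move=> fc; elim: s => //= i s IH; rewrite !ops_bind /= IH fc addn0 mulSn. Qed.

Lemma run_foldM (I A : Type) (f : A -> I -> prog R A) a s :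
  run (foldM f a s) = foldl (fun a i => run (f a i)) a s.
Proof. by elim: s a => //= i s IH a; rewrite run_bind IH. Qed.

Lemma ops_foldM (I A : Type) (f : A -> I -> prog R A) a s c :
  (forall a i, ops (f a i) = c) -> ops (foldM f a s) = (size s * c)%N.
Proof. by move=> fc; elim: s a => //= i s IH a; rewrite ops_bind IH fc mulSn. Qed.

Lemma foldl_addr (I : Type) (F : I -> R) a s :
  foldl (fun a i => a + F i) a s = a + \sum_(i <- s) F i.
Proof.
by elim: s a => [|i s IH] a /=; rewrite ?big_nil ?addr0// IH big_cons addrA.
Qed.

(** A nonnegative start absorbs the default 0 of the iterated maximum. *)
Lemma foldl_maxr (I : Type) (F : I -> R) a s : 0 <= a ->
  foldl (fun a i => Order.max a (F i)) a s =
  Order.max a (\big[Order.max/0]_(i <- s) F i).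
Proof.
elim: s a => [|i s IH] a a0 /=; first by rewrite big_nil max_l.
by rewrite IH ?le_max ?a0// big_cons maxA.
Qed.

Context (n : nat).

Lemma run_vecM (f : 'I_n -> prog R R) : run (vecM f) = [tuple run (f i) | i < n].
Proof.
rewrite /vecM run_bind run_mapM; apply: eq_from_tnth => i; rewrite !tnth_mktuple.
by rewrite (nth_map i) ?size_enum_ord// nth_ord_enum.
Qed.

Lemma ops_vecM (f : 'I_n -> prog R R) c : (forall i, ops (f i) = c) ->
  ops (vecM f) = (n * c)%N.
Proof. by move=> fc; rewrite /vecM ops_bind (ops_mapM _ fc) size_enum_ord addn0. Qed.

Lemma run_sum_prog (x : n.-tuple R) : run (sum_prog x) = \sum_(i < n) tnth x i.
Proof. by rewrite /sum_prog run_bind run_foldM foldl_addr add0r big_enum. Qed.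

Lemma ops_sum_prog (x : n.-tuple R) : ops (sum_prog x) = n.+1.
Proof. by rewrite /sum_prog ops_bind (@ops_foldM _ _ _ _ _ 1)// size_enum_ord muln1. Qed.

Variable C : 'M[R]_n.

Lemma run_max_entry_prog : run (max_entry_prog C) = max_entry C.
Proof.
rewrite /max_entry_prog run_bind run_foldM /=.
have inner a i : 0 <= a ->
    run (foldM (fun b j => Cmp b (C i j) (fun c => Ret (if c then C i j else b)))
      a (enum 'I_n)) = Order.max a (\big[Order.max/0]_(j < n) C i j).
  move=> a0; rewrite run_foldM -big_enum -foldl_maxr//.
  by elim: (enum _) a {a0} => //= j s IH a; rewrite IH maxEle.
rewrite /max_entry -big_enum/=.
have max0 (s : seq 'I_n) : 0 <= \big[Order.max/0]_(i <- s) \big[Order.max/0]_(j < n) C i j.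
  exact: bigmax_ge_id.
rewrite -[RHS](max_r (max0 _)) -foldl_maxr//.
have gen s (a : R) : 0 <= a ->
    foldl (fun a i => run (foldM (fun b j =>
        Cmp b (C i j) (fun c => Ret (if c then C i j else b))) a (enum 'I_n))) a s =
    foldl (fun a i => Order.max a (\big[Order.max/0]_(j < n) C i j)) a s.
  by elim: s a => //= i s IH a a0; rewrite inner// IH// le_max a0.
exact: gen.
Qed.

Lemma ops_max_entry_prog : ops (max_entry_prog C) = (n * n).+1.
Proof.
rewrite /max_entry_prog ops_bind (@ops_foldM _ _ _ _ _ n) ?size_enum_ord// => a i.
by rewrite (@ops_foldM _ _ _ _ _ 1)// size_enum_ord muln1.
Qed.

Lemma run_stepsize_prog N : run (stepsize_prog C N) = smd_stepsize C N.
Proof.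
rewrite /stepsize_prog /smd_stepsize -run_max_entry_prog.
by move: (max_entry_prog C) => mx; rewrite !run_bind.
Qed.

Lemma ops_stepsize_prog N : ops (stepsize_prog C N) = (n * n + 10)%N.
Proof.
rewrite /stepsize_prog; have := ops_max_entry_prog.
by move: (max_entry_prog C) => mx mxE; rewrite !ops_bind /= mxE /=; ring.
Qed.

Variable solver : n.-tuple R -> n.-tuple R -> prog R (n.-tuple R).
Let g p q := run (solver p q).

Lemma run_step_prog eta p q : run (step_prog solver eta p q) = smd_step g eta p q.
Proof.
rewrite /step_prog 4!run_bind run_vecM; apply: eq_from_tnth => i.
rewrite !tnth_mktuple run_sum_prog run_vecM !tnth_mktuple /= sub0r mulNr.
by congr (_ / _); apply: eq_bigr => j _; rewrite tnth_mktuple /= sub0r mulNr.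
Qed.

(** Beyond the solver call, each coordinate takes four operations for its weight, one addition and
    one division; two constants are loaded. *)
Lemma ops_step_prog eta p q :
  ops (step_prog solver eta p q) = (ops (solver p q) + (6 * n + 2))%N.
Proof.
rewrite /step_prog 4!ops_bind (@ops_vecM _ 4)// ops_sum_prog (@ops_vecM _ 1)//.
by rewrite /= -[n.+1]addn1; ring.
Qed.

(** Stated for an arbitrary starting index and accumulator so that the induction on the remaining
    samples goes through. *)
Lemma run_loop_prog eta (q : nat -> n.-tuple R) acc k m :
  run (loop_prog solver eta (smd_iter g eta q k) acc [seq q j | j <- iota k m]) =
  [tuple tnth acc i + \sum_(k <= j < k + m) tnth (smd_iter g eta q j) i | i < n].
Proof.
elim: m k acc => [|m IH] k acc /=.
  by apply: eq_from_tnth => i; rewrite tnth_mktuple addn0 big_geq// addr0.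
rewrite 2!run_bind run_step_prog -[smd_step _ _ _ _]/(smd_iter g eta q k.+1) IH.
apply: eq_from_tnth => i; rewrite run_vecM !tnth_mktuple /= -addrA; congr (_ + _).
by rewrite addnS -addSn [RHS]big_ltn// ltnS leq_addr.
Qed.

(** The solver cost is assumed bounded only along the actual iterates, since its guarantee is
    confined to the simplex. Accumulation adds [n] operations to each step. *)
Lemma ops_loop_prog eta (q : nat -> n.-tuple R) acc k m (c : R) :
  (forall j, (k <= j < k + m)%N ->
    (ops (solver (smd_iter g eta q j) (q j)))%:R <= c) ->
  (ops (loop_prog solver eta (smd_iter g eta q k) acc [seq q j | j <- iota k m]))%:R
  <= m%:R * (c + 7 * n%:R + 2).
Proof.
elim: m k acc => [|m IH] k acc cb /=; first by rewrite mul0r.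
rewrite 2!ops_bind (@ops_vecM _ 1)// run_step_prog ops_step_prog.
rewrite -[smd_step _ _ _ _]/(smd_iter g eta q k.+1).
set acc' := run _; have := IH k.+1 acc'; rewrite addSnnS => /(_ _)/wrap[j /andP[kj jm]|].
  by apply: cb; rewrite (ltnW kj).
have := cb k; rewrite leqnn addnS ltnS leq_addr => /(_ isT).
rewrite muln1 !natrD -[m.+1%:R]natr1; lra.
Qed.

Lemma run_smd_prog (q : nat -> n.-tuple R) N :
  run (smd_prog C solver (mkseq q N)) = smd_average C g N q.
Proof.
rewrite /smd_prog size_mkseq 7!run_bind run_stepsize_prog run_vecM.
rewrite /= div1r.
apply: eq_from_tnth => i; rewrite !tnth_mktuple /=.
rewrite (_ : [tuple n%:R^-1 | _ < n] = smd_iter g (smd_stepsize C N) q 0)//.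
by rewrite run_loop_prog !tnth_mktuple add0r add0n mulrC big_mkord.
Qed.

Lemma ops_smd_prog (q : nat -> n.-tuple R) N (c : R) :
  (forall j, (j < N)%N ->
    (ops (solver (smd_iter g (smd_stepsize C N) q j) (q j)))%:R <= c) ->
  (ops (smd_prog C solver (mkseq q N)))%:R <=
  15 + n%:R ^+ 2 + n%:R + N%:R * (c + 7 * n%:R + 2).
Proof.
move=> cb; rewrite /smd_prog size_mkseq 7!ops_bind ops_stepsize_prog.
rewrite run_stepsize_prog (@ops_vecM _ 1)//= div1r.
rewrite (_ : [tuple n%:R^-1 | _ < n] = smd_iter g (smd_stepsize C N) q 0)//.
have := @ops_loop_prog (smd_stepsize C N) q [tuple 0 | _ < n] 0 N c cb.
rewrite !natrD natrM muln1; lra.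
Qed.

End programs.

(** * Divergence from the uniform distribution, and assembly of the theorem *)

Lemma KL_uniform_le (R : realType) (n : nat) (p : n.-tuple R) : (0 < n)%N ->
  simplex R n p -> KL p (uniform R n) <= ln n%:R.
Proof.
move=> n0 sp; have [p0 p1] := sp; rewrite /KL sumrB p1.
have [_ ->] := uniform_simplex R n0; rewrite subrr subr0.
have -> : ln n%:R = \sum_i tnth p i * ln n%:R by rewrite -mulr_suml p1 mul1r.
apply: ler_sum => i _; rewrite ler_wpM2l// tnth_mktuple invrK.
(* At a zero coordinate [ln] takes its default value 0, which is still at most [ln n%:R]. *)
have [->|pi0] := eqVneq (tnth p i) 0.
  by rewrite mul0r ln0// ln_ge0// ler1n.
have pgt : 0 < tnth p i by rewrite lt_def pi0 p0.
rewrite ler_ln ?posrE ?mulr_gt0 ?ltr0n// ler_piMl//.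
exact: simplex_le1.
Qed.

Theorem theorem2p4p2 (R : realType) :
  exists K c : R, [/\ 0 < K, 0 < c &
  forall (a A : R) (b l : nat), exists (K' : R) (m : nat),
  forall (n : nat) (C : 'M[R]_n)
    (solver : n.-tuple R -> n.-tuple R -> prog R (n.-tuple R))
    (P : probability (n.-tuple R) R) (pstar : n.-tuple R) (beta : R),
  (0 < n)%N -> cost_matrix C -> 0 < max_entry C ->
  lp_solver C a b solver ->
  P (simplex R n) = 1%E -> mean_OT_argmin C P pstar ->
  0 < beta < 1 ->
  let g := fun p q => run (solver p q) in
  [/\ forall (N : nat) (d : measure_display) (T : measurableType d)
        (Pr : probability T R) (X : nat -> {RV Pr >-> n.-tuple R}),
        (0 < N)%N -> iid_samples N P X ->
        with_probability Pr (1 - beta)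
          [set w | mean_OT C P (smd_average C g N (fun k => X k w))
                     - mean_OT C P pstar
                   <= K * (max_entry C * Num.sqrt (ln (n%:R / beta))
                           / Num.sqrt N%:R)],
      forall q : n.-tuple R, simplex R n q ->
        l1_lipschitz (max_entry C) (fun p => OT C p q),
      KL pstar (uniform R n) <= ln n%:R &
      forall (eps : R) (N : nat), 0 < eps ->
        c * (max_entry C ^+ 2 / eps ^+ 2) * ln (n%:R / beta) <= N%:R ->
        N%:R <= A * (max_entry C ^+ 2 / eps ^+ 2)
                  * (1 + ln (n%:R / beta)) ^+ l ->
        (forall (d : measure_display) (T : measurableType d)
           (Pr : probability T R) (X : nat -> {RV Pr >-> n.-tuple R}),
           iid_samples N P X ->
           with_probability Pr (1 - beta)
             [set w | mean_OT C P (smd_average C g N (fun k => X k w))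
                        - mean_OT C P pstar <= eps])
        /\
        (forall q : nat -> n.-tuple R,
           (forall k, (k < N)%N -> simplex R n (q k)) ->
           run (smd_prog C solver (mkseq q N)) = smd_average C g N q /\
           (ops (smd_prog C solver (mkseq q N)))%:R
             <= K' * (n%:R ^+ 3 * max_entry C ^+ 2 / eps ^+ 2)
                   * (1 + ln (n%:R / beta)) ^+ m)]].
Proof.
(* The 10 is that of the high-probability bound; its square 100 is what makes this bound at most
   [eps] for the prescribed [N]. *)
exists 10, 100; split => // a A b l.
(* The exponents of the solver cost and of the sample size add up. The absolute value covers a
   negative [a], and 26 collects the coefficients 15, 1, 1, 7 and 2 of [ops_smd_prog]. *)
exists ((`|a| + 26) * A), (b + l)%N.
move=> n C solver P pstar beta n0 cC M0 [grad mg opsb] PS [sstar argmin] beta01 g.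
have [b0 b1] := andP beta01.
set M := max_entry C; set L := ln (n%:R / beta).
have n1 : 1 <= (n%:R : R) by rewrite ler1n.
have lnL : ln n%:R <= L.
  rewrite ler_ln ?posrE ?ltr0n ?divr_gt0 ?ltr0n// ler_pdivlMr// ler_piMr//.
  exact: ltW.
have L0 : 0 < L by rewrite ln_gt0// ltr_pdivlMr// mul1r (lt_le_trans b1).
have high := @smd_high_probability R n C g P pstar n0 cC M0 grad mg sstar.
split.
- by move=> N d T Pr X N0 iidX; exact: high.
- move=> q sq; apply: OT_lipschitz => // p sp.
  by have [[v uv] _] := grad p q sp sq; exists (g p q), v.
- exact: KL_uniform_le.
move=> eps N eps0 Nlow Nup.
have e20 : 0 < eps ^+ 2 by rewrite exprn_gt0.
have N0 : (0 < N)%N.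
  rewrite -(ltr0n R); apply: lt_le_trans Nlow.
  by rewrite mulr_gt0// mulr_gt0// divr_gt0// exprn_gt0.
have Nr : (0 : R) < N%:R by rewrite ltr0n.
split => [d T Pr X iidX|q sq].
  have [_ hp] := high N N0 d T Pr X iidX beta beta01.
  have mgap := @smd_gap_measurable R n C g P pstar n0 cC M0 grad mg N N0 d T Pr X iidX.
  split; first exact: mgap.
  apply: le_trans hp _; apply: le_measure; rewrite ?inE; try exact: mgap.
  move=> w /= /le_trans; apply.
  have s0 : 0 < Num.sqrt (N%:R : R) by rewrite sqrtr_gt0.
  rewrite mulrA ler_pdivrMr// -/M -/L.
  rewrite -(@ler_pXn2r _ 2) ?nnegrE ?mulr_ge0 ?sqrtr_ge0 ?(ltW M0) ?(ltW eps0)//.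
  rewrite !exprMn !sqr_sqrtr ?(ltW L0) ?(ltW Nr)//.
  have -> : 10 ^+ 2 * (M ^+ 2 * L) = eps ^+ 2 * (100 * (M ^+ 2 / eps ^+ 2) * L).
    by field; rewrite gt_eqF.
  by rewrite ler_pM2l.
split; first exact: run_smd_prog.
have lnn0 : 0 <= ln (n%:R : R) by rewrite ln_ge0.
have E1 k : 1 <= (1 + L) ^+ k by rewrite exprn_ege1// lerDl ltW.
pose D : R := n%:R ^+ 3.
have D1 : 1 <= D by rewrite exprn_ege1.
set Eb := (1 + L) ^+ b.
have cb j : (j < N)%N ->
    (ops (solver (smd_iter g (smd_stepsize C N) q j) (q j)))%:R <= `|a| * D * Eb.
  move=> jN; apply: le_trans (opsb _ _ (smd_iter_simplex _ _ _ n0 j) (sq j jN)) _.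
  apply: (@le_trans _ _ (`|a| * D * (1 + ln n%:R) ^+ b)).
    apply: ler_wpM2r; first by rewrite exprn_ge0// addr_ge0.
    by apply: ler_wpM2r; [exact: exprn_ge0|exact: ler_norm].
  rewrite ler_wpM2l ?mulr_ge0 ?exprn_ge0// lerXn2r ?nnegrE ?addr_ge0 ?(ltW L0)//.
  by rewrite lerD2l.
apply: le_trans (ops_smd_prog cb) _.
have nD : n%:R <= D by rewrite /D -[X in X <= _]expr1 ler_weXn2l.
have n2D : n%:R ^+ 2 <= D by rewrite /D ler_weXn2l.
have Nr1 : 1 <= (N%:R : R) by rewrite ler1n.
have DEb : D <= D * Eb by rewrite ler_peMr ?E1// (le_trans ler01).
have NDEb : D * Eb <= N%:R * (D * Eb).
  by rewrite ler_peMl// mulr_ge0 ?(le_trans ler01 D1)// (le_trans ler01 (E1 b)).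
have Nn : N%:R * n%:R <= N%:R * (D * Eb) by rewrite ler_pM2l// (le_trans nD).
have N1 : N%:R <= N%:R * (D * Eb) by rewrite ler_peMr ?(ltW Nr)// (le_trans D1).
(* Every term outside the solver calls is absorbed into [N%:R * (D * Eb)], as [N], [n], [D] and [Eb]
   are all at least 1; the upper bound on [N] then finishes. *)
apply: (@le_trans _ _ ((`|a| + 26) * D * Eb * N%:R)); first lra.
have -> : (`|a| + 26) * A * (n%:R ^+ 3 * M ^+ 2 / eps ^+ 2) * (1 + L) ^+ (b + l) =
    (`|a| + 26) * D * Eb * (A * (M ^+ 2 / eps ^+ 2) * (1 + L) ^+ l).
  by rewrite exprD -/Eb /D; ring.
by rewrite ler_wpM2l// mulr_ge0 ?mulr_ge0 ?addr_ge0 ?(le_trans ler01 (E1 b)).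
Qed.
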